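(* Let $X$ be a non-empty set. For a positive definite kernel $K$ on $X$ the following conditions are equivalent: (a1) $K$ has a pdms root; (a2) there exists an $\ell_2$-kernel $L$ on $X$ such that $K=L*L^*$; (b) the set $X$ admits a decomposition $X=\bigsqcup_{s\in S}X_s$ into (pairwise disjoint) non-empty (at most) countable sets such that $K=\bigoplus_{s\in S}K|_{X_s\times X_s}$ and each of $K|_{X_s\times X_s}$ has a pdms root; (c1) there exists a closable operator that factorizes $K$; (c2) there exists a positive self-adjoint operator $B$ in $\ell_2(X)$ that factorizes $K$ and has $\ell_{fin}(X)$ as a core; (c3) $K_{op}\colon\ell_{fin}(X)\to\mathcal H_K$ is closable; (d) $\ell_2(X)\cap\mathcal H_K$ is dense in $\mathcal H_K$; (e1) whenever a sequence $(\alpha_n)_{n=1}^\infty\subset\ell_{fin}(X)$ norm converges to $0$ (in $\ell_2(X)$) and consists of $K$-unit vectors, then $\lim_{n\to\infty}\sum_{x\in X}\alpha_n(x)K(x,z)=0$ for all $z\in X$; (e2) for any $z\in X$ and $\varepsilon>0$ there is a finite non-empty set $F\subset X$ such that: if a $K$-unit vector $f\in\ell_{fin}(X)$ vanishes at each point of $F$ and has $\ell_2(X)$-norm not exceeding $1$, then $|\sum_{x\in X}f(x)K(x,z)|\le\varepsilon$; (e3) for any $z\in X$ and $\varepsilon>0$ there are a finite orthonormal system $u_1,\ldots,u_k$ in $\ell_2(X)$ and $\delta>0$ such that: if a $K$-unit vector $v\in\ell_{fin}(X)$ satisfies $|\langle v,u_j\rangle_{\ell_2(X)}|\le\delta$ for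 $j=1,\ldots,k$, then $|\sum_{x\in X}v(x)K(x,z)|\le\varepsilon$.
   Context: Hilbert spaces are complex; inner products are linear in the first variable. $\ell_2(X)$ is the Hilbert space of square-summable functions $X\to\mathbb C$, with canonical basis $(e_x)_{x\in X}$, and $\ell_{fin}(X)$ is the linear span of the $e_x$, equipped with the norm of $\ell_2(X)$. A kernel on $X$ is a function $K\colon X\times X\to\mathbb C$; it is positive definite (pd) if $\sum_{j,k=1}^n\lambda_j\overline{\lambda_k}K(x_j,x_k)\ge0$ for all $n\ge1$, $x_j\in X$, $\lambda_j\in\mathbb C$. A kernel $K$ is an $\ell_2$-kernel if $K(x,\cdot),K(\cdot,x)\in\ell_2(X)$ for every $x\in X$. For $\ell_2$-kernels $K,L$ on $X$, $(K*L)(x,z)=\sum_{y\in X}K(x,y)L(y,z)$, and $K^*(x,y)=\overline{K(y,x)}$. A pd kernel $L$ on $X$ is a pdms root (positive definite matrix-type square root) of a pd kernel $K$ if $K(x,z)=\sum_{y\in X}L(x,y)L(y,z)$ for all $x,z\in X$ (equivalently, $L$ is a pd $\ell_2$-kernel with $L*L=K$). If $X=\bigsqcup_{s\in S}X_s$ and $K_s$ is a kernel on $X_s$, then $\bigoplus_{s\in S}K_s$ is the kernel on $X$ equal to $K_t(x,y)$ for $x,y\in X_t$ and to $0$ if $x,y$ lie in different sets $X_s$. For a pd kernel $K$, $\mathcal H_K$ is the unique Hilbert space of functions $X\to\mathbb C$ such that $K(x,\cdot)\in\mathcal H_K$ and $f(x)=\langle f,K(x,\cdot)\rangle_{\mathcal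 H_K}$ for all $x\in X$, $f\in\mathcal H_K$. $K_{op}$ is the linear operator on $\ell_{fin}(X)$ with $K_{op}(e_x)=K(x,\cdot)$; here it has target $\mathcal H_K$ and its domain $\ell_{fin}(X)$ is regarded as a subspace of $\ell_2(X)$. A linear operator $T\colon\mathcal D(T)\to H$, with $\ell_{fin}(X)\subset\mathcal D(T)\subset\ell_2(X)$ and $H$ a Hilbert space, factorizes $K$ if $K(x,y)=\langle Te_x,Te_y\rangle_H$ for all $x,y\in X$. An operator is closable if the closure of its graph is the graph of an operator (its closure); a subspace $\mathcal D$ of the domain of a closed operator $B$ is a core of $B$ if $B$ is the closure of $B|_{\mathcal D}$. An operator $B$ is positive if $\langle Bf,f\rangle\ge0$ for all $f\in\mathcal D(B)$. A vector $u\in\ell_{fin}(X)$ is $K$-unit if $\sum_{x,y\in X}u(x)\overline{u(y)}K(x,y)\le1$. *)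

(* Defs.v *)
From HB Require Import structures.
From mathcomp Require Import all_boot all_order all_algebra.
From mathcomp Require Import finmap.
From mathcomp Require Import complex.
From mathcomp Require Import all_classical all_reals.
From mathcomp Require Import ereal topology normedtype sequences esum.
From mathcomp Require Import ring.
From mathcomp Require summability.

Set Implicit Arguments.
Unset Strict Implicit.
Unset Printing Implicit Defensive.

Import Order.TTheory GRing.Theory Num.Theory.
Import numFieldNormedType.Exports.

Local Open Scope classical_set_scope.
Local Open Scope ring_scope.

(* R[i] does not inherit the topology that a numFieldType carries as R[i]^o. *)
HB.instance Definition _ (R : realType) := NormedModule.copy R[i] (R[i]^o).

Section complex_complete.
Variable R : realType.
Implicit Types (z : R[i]).

Lemma normc_ge_Im z : `|complex.Im z|%:C%C <= `|z|.
Proof.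
have := normc_ge_Re (z * 'i%C).
rewrite ReiNIm normrN normrM (_ : `|'i%C| = 1 :> R[i]) ?mulr1 //.
by rewrite normc_def /= expr0n expr1n add0r sqrtr1.
Qed.

Lemma normc_le_ReIm z :
  `|z| <= (`|complex.Re z| + `|complex.Im z|)%:C%C.
Proof.
rewrite {1}(complexE z) (le_trans (ler_normD _ _))// normrM.
rewrite (_ : `|'i%C| = 1 :> R[i]) ?mul1r; last first.
  by rewrite normc_def /= expr0n expr1n add0r sqrtr1.
by rewrite !normc_def /= expr0n /= !addr0 !sqrtr_sqr -rmorphD.
Qed.

Lemma complex_complete (F : set_system R[i]) :
  ProperFilter F -> cauchy F -> cvg F.
Proof.
move=> FF /cauchy_ballP Fc; apply/cvg_ex => /=.
have cvgpart (g : R[i] -> R) : {morph g : x y / x - y} ->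
    (forall z, `|g z|%:C%C <= `|z|) -> cvg (g @ F).
  move=> gB gle; apply/cauchy_cvgP/cauchy_ballP => e e0.
  have e0' : 0 < e%:C%C by rewrite ltcR.
  have := Fc _ e0'; rewrite !near_simpl => Fe.
  rewrite near_map2; apply: filterS Fe => -[x y] /=.
  rewrite -!ball_normE /ball_ /= => xy.
  by rewrite -gB -ltcR (le_lt_trans (gle _)).
have /cvg_ex[/= a aF] : cvg ((@complex.Re R) @ F).
  by apply: cvgpart; [move=> [? ?] [? ?]|exact: normc_ge_Re].
have /cvg_ex[/= b bF] : cvg ((@complex.Im R) @ F).
  by apply: cvgpart; [move=> [? ?] [? ?]|exact: normc_ge_Im].
exists (a +i* b)%C; apply/cvgrPdist_lt => e e0.
have e2 : 0 < complex.Re e / 2.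
  by move: e0; rewrite ltcE /= => /andP[_ ?]; rewrite divr_gt0.
move/cvgrPdist_lt : aF => /(_ _ e2) aF.
move/cvgrPdist_lt : bF => /(_ _ e2) bF.
have ReB z : complex.Re ((a +i* b)%C - z) = a - complex.Re z by case: z.
have ImB z : complex.Im ((a +i* b)%C - z) = b - complex.Im z by case: z.
near=> z; apply: le_lt_trans (normc_le_ReIm _) _.
rewrite -(RRe_real (gtr0_real e0)) ltcR (splitr (complex.Re e)).
by rewrite ReB ImB; apply: ltrD; near: z.
Unshelve. all: by end_near. Qed.

End complex_complete.

HB.instance Definition _ (R : realType) :=
  Uniform_isComplete.Build R[i] (@complex_complete R).

Section dot_norm.
Variables (C : numClosedFieldType) (V : lmodType C).
Variable form : {dot V for Num.conj}.
Local Notation "''[' u , v ]" := (form u v).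

Definition dot_norm (u : V) : C := sqrtC '[u, u].

Lemma dot_normK u : dot_norm u ^+ 2 = '[u, u].
Proof. exact: sqrtCK. Qed.

Lemma dot_norm_ge0 u : 0 <= dot_norm u.
Proof. by rewrite sqrtC_ge0 dnorm_ge0. Qed.

Lemma dot_normZ a u : dot_norm (a *: u) = `|a| * dot_norm u.
Proof.
by rewrite /dot_norm dnormZ sqrtCM ?nnegrE ?dnorm_ge0 ?exprn_ge0// sqrCK.
Qed.

Lemma dot_norm0_eq0 u : dot_norm u = 0 -> u = 0.
Proof. by move/eqP; rewrite sqrtC_eq0 dnorm_eq0 => /eqP. Qed.

Lemma dot_CauchySchwarz u v : `|'[u, v]| <= dot_norm u * dot_norm v.
Proof.
rewrite -ler_sqr ?nnegrE ?mulr_ge0 ?dot_norm_ge0// exprMn !dot_normK.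
have [->|v0] := eqVneq v 0.
  by rewrite !linear0r normr0 expr0n mulr0.
have vv0 : 0 < '[v, v] by rewrite dnorm_gt0.
pose a := '[u, v] / '[v, v]; pose w := u - a *: v.
have wv : '[w, v] = 0.
  by rewrite /w linearBl/= linearZl_LR/= divfK ?subrr// gt_eqF.
have -> : '[u, u] = '[w, w] + `|a| ^+ 2 * '[v, v].
  rewrite -dnormZ -hnormDd; first by rewrite /w subrK.
  by rewrite linearZr_LR/= wv mulr0.
rewrite mulrDl -mulrA -expr2 /a normrM normfV (gtr0_norm vv0) exprMn exprVn.
rewrite divfK ?expf_neq0 ?gt_eqF// lerDr.
by rewrite mulr_ge0 ?dnorm_ge0.
Qed.

Lemma ler_dot_normD u v : dot_norm (u + v) <= dot_norm u + dot_norm v.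
Proof.
rewrite -ler_sqr ?nnegrE ?addr_ge0 ?dot_norm_ge0// dot_normK dnormD sqrrD.
rewrite !dot_normK addrAC -addrA [leRHS]addrAC -addrA lerD2l//.
rewrite addrC lerD2l.
have CS := dot_CauchySchwarz u v.
have d2 : '[u, v] + ('[u, v])^* <= `|'[u, v]| *+ 2.
  rewrite (le_trans (real_ler_norm _))//.
    by apply/CrealP; rewrite rmorphD /= conjCK addrC.
  by rewrite (le_trans (ler_normD _ _))// norm_conjC mulr2n.
by rewrite (le_trans d2)// lerMn2r CS orbT.
Qed.

End dot_norm.

(* Norms and inner products are R[i]-valued; inner is linear in its first
   variable. *)
HB.mixin Record isHilbert (R : realType) H & CompleteNormedModule R[i] H := {
  inner : {dot H for @Num.conj R[i]};
  normr_inner : forall u : H, `|u| ^+ 2 = inner u u }.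

#[short(type="hilbertType")]
HB.structure Definition Hilbert (R : realType) :=
  {H of isHilbert R H & CompleteNormedModule R[i] H}.

#[export] Existing Instance summability.totally_filter.

Section unordered_sums.
Variables (R : realType) (X : choiceType).
Implicit Types (f g : X -> R[i]) (s t : R[i]) (A : {fset X}).

(* Unordered sums: partial sums over finite sets converge along inclusion. *)
Definition has_sum f s :=
  summability.partial_sum f @ summability.totally --> s.

Lemma partial_sumE f A : summability.partial_sum f A = \sum_(x <- A) f x.
Proof. by rewrite /summability.partial_sum big_seq_fsetE. Qed.

Lemma has_sumP f s : has_sum f s <->
  forall e : R[i], 0 < e -> exists A, forall B, (A `<=` B)%fset ->
    `|s - \sum_(x <- B) f x| < e.
Proof.
split=> [/cvgrPdist_lt fs e /fs [A _ AB]|fs].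
  by exists A => B /AB /=; rewrite partial_sumE.
apply/cvgrPdist_lt => e /fs [A AB]; exists A => // B /AB.
by rewrite /= partial_sumE.
Qed.

Lemma sum_has_sum f s : has_sum f s -> summability.sum f = s.
Proof. by move=> fs; apply: (cvg_lim _ fs); exact: norm_hausdorff. Qed.

Lemma has_sumD f g s t :
  has_sum f s -> has_sum g t -> has_sum (fun x => f x + g x) (s + t).
Proof.
move=> /has_sumP fs /has_sumP gt; apply/has_sumP => e e0.
have e2 : 0 < e / 2 by rewrite divr_gt0.
have [A fA] := fs _ e2; have [B gB] := gt _ e2.
exists (A `|` B)%fset => D; rewrite fsubUset => /andP[/fA fD /gB gD].
rewrite big_split /= opprD addrACA (splitr e).
by rewrite (le_lt_trans (ler_normD _ _))// ltrD.
Qed.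

Lemma has_sumZ f s a : has_sum f s -> has_sum (fun x => a * f x) (a * s).
Proof.
move=> /has_sumP fs; apply/has_sumP => e e0.
have [->|a0] := eqVneq a 0.
  exists fset0 => B _; rewrite mul0r big1 ?subrr ?normr0// => x _.
  by rewrite mul0r.
have [|A AB] := fs (e / `|a|); first by rewrite divr_gt0 ?normr_gt0.
exists A => B /AB; rewrite -mulr_sumr -mulrBr normrM ltr_pdivlMr ?normr_gt0//.
by rewrite mulrC.
Qed.

Lemma has_sum_conj f s : has_sum f s -> has_sum (fun x => (f x)^*) s^*.
Proof.
move=> /has_sumP fs; apply/has_sumP => e /fs [A AB]; exists A => B /AB.
by rewrite -rmorph_sum -rmorphB norm_conjC.
Qed.

Lemma ler_sum_fset (h : X -> R) A B : (forall x, 0 <= h x) ->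
  (A `<=` B)%fset -> \sum_(x <- A) h x <= \sum_(x <- B) h x.
Proof.
move=> h0 AB; rewrite (big_fsetID _ (mem A) B) /=.
rewrite (_ : [fset x in B | x \in A]%fset = A) ?lerDl ?sumr_ge0//.
apply/fsetP => x; rewrite !inE /=.
by case: (boolP (x \in A)) => xA; rewrite ?andbF// (fsubsetP AB).
Qed.

Lemma has_sum_nneg (h : X -> R) M : (forall x, 0 <= h x) ->
  (forall A, \sum_(x <- A) h x <= M) ->
  exists s : R, [/\ has_sum (fun x => (h x)%:C%C) s%:C%C, s <= M &
    forall A, \sum_(x <- A) h x <= s].
Proof.
move=> h0 hM; pose E := range (fun A => \sum_(x <- A) h x).
have E0 : E !=set0 by exists (\sum_(x <- fset0) h x); exists fset0.
have hE : has_sup E by split=> //; exists M => _ [A _ <-].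
have leE A : \sum_(x <- A) h x <= sup E.
  by apply: (ub_le_sup hE.2); exists A.
exists (sup E); split => //; last by apply: ge_sup => // _ [A _ <-].
apply/has_sumP => e e0.
have eR := RRe_real (gtr0_real e0).
have [|_ [A _ <-] Ae] := @sup_adherent _ _ (complex.Re e) _ hE.
  by rewrite -ltcR eR.
exists A => B AB; rewrite -rmorph_sum -rmorphB normc_def /= expr0n /= addr0.
rewrite sqrtr_sqr -eR ltcR ger0_norm ?subr_ge0// ltrBlDl -ltrBlDr.
by rewrite (lt_le_trans Ae) ?ler_sum_fset.
Qed.

Lemma has_sum_abs f M : (forall A, \sum_(x <- A) `|f x| <= M%:C%C) ->
  exists s, has_sum f s.
Proof.
move=> fM; pose h x := complex.Re `|f x|.
have hE x : `|f x| = (h x)%:C%C by rewrite RRe_real// normr_real.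
have [|A|S [/has_sumP hS _ leS]] := @has_sum_nneg h M.
- by move=> x; rewrite -ler0c -hE.
- by rewrite -lecR rmorph_sum -(eq_bigr _ (fun x _ => hE x)).
apply/cvg_ex/cauchy_cvgP/cauchy_exP => e /hS [A AB].
exists (\sum_(x <- A) f x); exists A => // B AsubB.
rewrite /= -ball_normE /= partial_sumE.
have BAE (T : zmodType) (k : X -> T) :
    \sum_(x <- A) k x - \sum_(x <- B) k x =
    - \sum_(x <- [fset x in B | x \notin A]%fset) k x.
  rewrite (big_fsetID _ (mem A) B) /=.
  rewrite (_ : [fset x in B | x \in A]%fset = A) ?opprD ?addrA ?subrr ?sub0r//.
  apply/fsetP => x; rewrite !inE /=.
  by case: (boolP (x \in A)) => xA; rewrite ?andbF// (fsubsetP AsubB).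
rewrite BAE normrN (le_lt_trans (ler_norm_sum _ _ _))//.
rewrite (eq_bigr _ (fun x _ => hE x)) -rmorph_sum.
have -> : \sum_(x <- [fset x in B | x \notin A]%fset) h x =
   \sum_(x <- B) h x - \sum_(x <- A) h x by rewrite -opprB BAE opprK.
apply: le_lt_trans (AB A (fsubset_refl _)).
rewrite -rmorph_sum -rmorphB normc_def /= expr0n /= addr0 sqrtr_sqr lecR.
by rewrite (le_trans _ (ler_norm _))// lerB.
Qed.

End unordered_sums.

Section l2_space.
Variables (R : realType) (X : choiceType).

Definition square_summable (f : X -> R[i]) : Prop :=
  (\esum_(x in [set: X]) (complex.Re `|f x| ^+ 2)%:E < +oo)%E.

Lemma Re_normE (z : R[i]) : (complex.Re `|z|)%:C%C = `|z|.
Proof. by rewrite RRe_real// normr_real. Qed.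

Lemma sqr_normD_le (u v : R[i]) :
  `|u + v| ^+ 2 <= 2 * (`|u| ^+ 2 + `|v| ^+ 2).
Proof.
apply: (@le_trans _ _ ((`|u| + `|v|) ^+ 2)).
  by rewrite ler_sqr ?nnegrE ?addr_ge0// ler_normD.
rewrite -subr_ge0 (_ : _ - _ = (`|u| - `|v|) ^+ 2); last by ring.
by rewrite real_exprn_even_ge0// realB ?normr_real.
Qed.

Lemma square_summableP (f : X -> R[i]) : square_summable f <->
  exists M : R, forall A : {fset X}, \sum_(x <- A) `|f x| ^+ 2 <= M%:C%C.
Proof.
pose h x := complex.Re `|f x| ^+ 2.
have h0 x : 0 <= h x by rewrite sqr_ge0.
have hE (A : {fset X}) :
    \sum_(x <- A) `|f x| ^+ 2 = (\sum_(x <- A) h x)%:C%C.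
  by rewrite rmorph_sum; apply: eq_bigr => x _; rewrite rmorphXn/= Re_normE.
split=> [fs|[M fM]]; last first.
  apply: (@le_lt_trans _ _ M%:E); last exact: ltry.
  apply: ge_ereal_sup => _ [A [Afin _] <-].
  rewrite fsbig_finite// sumEFin lee_fin -lecR -hE; exact: fM.
have s0 : (0 <= \esum_(x in [set: X]) (h x)%:E)%E.
  by apply: esum_ge0 => x _; rewrite lee_fin.
exists (fine (\esum_(x in [set: X]) (h x)%:E)) => A.
rewrite hE lecR -lee_fin fineK ?ge0_fin_numE// -sumEFin.
apply: esum_ge; exists [set` A] => //.
by rewrite fsbig_finite//= set_fsetK.
Qed.

Definition square_summable_pred : {pred X -> R[i]} :=
  fun f => `[< square_summable f >].

Lemma square_summable_closed : submod_closed square_summable_pred.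
Proof.
split=> [|a f g /asboolP/square_summableP[M fM] /asboolP/square_summableP[N gN]].
  apply/asboolP/square_summableP; exists 0 => A.
  by rewrite big1// => x _; rewrite normr0 expr0n.
apply/asboolP/square_summableP.
exists (2 * ((complex.Re `|a|) ^+ 2 * M + N)) => A.
rewrite rmorphM /= rmorph_nat rmorphD rmorphM /= rmorphXn /= Re_normE.
apply: (@le_trans _ _ (\sum_(x <- A)
    2 * (`|a| ^+ 2 * `|f x| ^+ 2 + `|g x| ^+ 2))).
  apply: ler_sum => x _; rewrite -exprMn -normrM.
  exact: sqr_normD_le.
rewrite -mulr_sumr big_split /= -mulr_sumr ler_pM2l//.
  by rewrite lerD// ler_wpM2l ?exprn_ge0.
Qed.

HB.instance Definition _ := GRing.isSubmodClosed.Build R[i] (X -> R[i])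
  square_summable_pred square_summable_closed.

Record l2 := L2 {
  l2_fun :> X -> R[i];
  l2_funP : square_summable_pred l2_fun }.

HB.instance Definition _ := [isSub for l2_fun].
HB.instance Definition _ := [Choice of l2 by <:].
HB.instance Definition _ := [SubChoice_isSubLmodule of l2 by <:].

Implicit Types f g h : l2.

Lemma l2_square_summable f : square_summable f.
Proof. exact/asboolP/l2_funP. Qed.

Lemma l2P f g : (forall x, f x = g x) -> f = g.
Proof. by move=> fg; apply/val_inj/funext. Qed.

Lemma l2DE f g x : (f + g) x = f x + g x. Proof. by []. Qed.
Lemma l2ZE a f x : (a *: f) x = a * f x. Proof. by []. Qed.
Lemma l2BE f g x : (f - g) x = f x - g x. Proof. by []. Qed.
Lemma l2_0E x : (0 : l2) x = 0. Proof. by []. Qed.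

Lemma l2_has_sum f g : has_sum (fun x => f x * (g x)^*)
  (summability.sum (fun x => f x * (g x)^*)).
Proof.
suff [s fgs] : exists s, has_sum (fun x => f x * (g x)^*) s.
  by rewrite (sum_has_sum fgs).
have /square_summableP[M fM] := l2_square_summable f.
have /square_summableP[N gN] := l2_square_summable g.
apply: (@has_sum_abs _ _ _ (M + N)) => A; rewrite rmorphD /=.
apply: le_trans (lerD (fM A) (gN A)); rewrite -big_split /=.
apply: ler_sum => x _; rewrite normrM norm_conjC.
apply: (@le_trans _ _ (`|f x| * `|g x| *+ 2)).
  by rewrite mulr2n lerDl mulr_ge0.
rewrite -subr_ge0 (_ : _ - _ = (`|f x| - `|g x|) ^+ 2); last by ring.
by rewrite real_exprn_even_ge0// realB ?normr_real.
Qed.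

Definition l2_dot (f g : l2) : R[i] :=
  summability.sum (fun x => f x * (g x)^*).

Lemma l2_dot_hermitian f g : l2_dot f g = (-1) ^+ false * (l2_dot g f)^*.
Proof.
rewrite expr0 mul1r; apply: sum_has_sum.
rewrite (_ : (fun _ => _) = fun x => (g x * (f x)^*)^*).
  exact/has_sum_conj/l2_has_sum.
by apply/funext => x; rewrite rmorphM /= conjCK mulrC.
Qed.

Lemma l2_dot_linearl h a f g :
  l2_dot (a *: f + g) h = a * l2_dot f h + l2_dot g h.
Proof.
apply: sum_has_sum; rewrite (_ : (fun _ => _) =
   fun x => a * (f x * (h x)^*) + g x * (h x)^*).
  by apply: has_sumD; [apply: has_sumZ|]; exact: l2_has_sum.
by apply/funext => x; rewrite l2DE l2ZE mulrDl mulrA.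
Qed.

Lemma l2_dot_is_bilinear : bilinear_for
  (GRing.Scale.Law.clone _ _ *%R _)
  (GRing.Scale.Law.clone _ _ (Num.conj \; *%R) _) l2_dot.
Proof.
split=> [h|h] a f g /=; first exact: l2_dot_linearl.
rewrite 3!(l2_dot_hermitian h) l2_dot_linearl !expr0 !mul1r.
by rewrite rmorphD rmorphM.
Qed.

HB.instance Definition _ := bilinear_isBilinear.Build R[i] l2 l2 R[i]
  (GRing.Scale.Law.clone _ _ *%R _)
  (GRing.Scale.Law.clone _ _ (Num.conj \; *%R) _) l2_dot l2_dot_is_bilinear.

HB.instance Definition _ := @isHermitianSesquilinear.Build R[i] l2 false
  Num.conj l2_dot l2_dot_hermitian.

Lemma l2_dot_ge_sum f (A : {fset X}) :
  \sum_(x <- A) `|f x| ^+ 2 <= l2_dot f f.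
Proof.
have /square_summableP[M fM] := l2_square_summable f.
have hE x : f x * (f x)^* = (complex.Re `|f x| ^+ 2)%:C%C.
  by rewrite rmorphXn /= Re_normE normCK.
have [|B|s [fs _ les]] := @has_sum_nneg R X
    (fun x => complex.Re `|f x| ^+ 2) M.
- by move=> x; rewrite sqr_ge0.
- rewrite -lecR rmorph_sum (le_trans _ (fM B))// le_eqVlt; apply/orP; left.
  by apply/eqP/eq_bigr => x _; rewrite rmorphXn /= Re_normE.
rewrite /l2_dot (funext hE) (sum_has_sum fs).
rewrite (le_trans _ (_ : (\sum_(x <- A) complex.Re `|f x| ^+ 2)%:C%C <= _))//.
  rewrite rmorph_sum le_eqVlt; apply/orP; left.
  by apply/eqP/eq_bigr => x _; rewrite rmorphXn /= Re_normE.
by rewrite lecR.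
Qed.

Lemma l2_dot_le f (M : R) :
  (forall A : {fset X}, \sum_(x <- A) `|f x| ^+ 2 <= M%:C%C) ->
  l2_dot f f <= M%:C%C.
Proof.
move=> fM.
have hE x : f x * (f x)^* = (complex.Re `|f x| ^+ 2)%:C%C.
  by rewrite rmorphXn /= Re_normE normCK.
have [|B|s [fs sM _]] := @has_sum_nneg R X
    (fun x => complex.Re `|f x| ^+ 2) M.
- by move=> x; rewrite sqr_ge0.
- rewrite -lecR rmorph_sum (le_trans _ (fM B))// le_eqVlt; apply/orP; left.
  by apply/eqP/eq_bigr => x _; rewrite rmorphXn /= Re_normE.
by rewrite /l2_dot (funext hE) (sum_has_sum fs) lecR.
Qed.

Lemma l2_dot_gt0 f : f != 0 -> 0 < l2_dot f f.
Proof.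
move=> f0; suff [x fx] : exists x, f x != 0.
  apply: lt_le_trans (l2_dot_ge_sum f [fset x]%fset).
  by rewrite big_seq_fset1 exprn_gt0 ?normr_gt0.
apply: contrapT => /forallNP fx; move/eqP: f0; apply; apply: l2P => x.
by have /negP/negPn/eqP := fx x.
Qed.

HB.instance Definition _ := isDotProduct.Build R[i] l2 l2_dot l2_dot_gt0.

HB.instance Definition _ := Lmodule_isNormed.Build R[i] l2
  (ler_dot_normD l2_dot) (dot_normZ l2_dot) (@dot_norm0_eq0 _ _ l2_dot).

Lemma l2_normK f : `|f| ^+ 2 = l2_dot f f.
Proof. exact: dot_normK. Qed.

Lemma ler_l2_norm f x : `|f x| <= `|f|.
Proof.
rewrite -ler_sqr ?nnegrE// l2_normK.
by have := l2_dot_ge_sum f [fset x]%fset; rewrite big_seq_fset1.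
Qed.

Lemma near_sum_sqr (F : set_system l2) (FF : Filter F) (g : X -> R[i])
    (s : seq X) (e : R[i]) : (forall x, (fun h : l2 => h x) @ F --> g x) ->
  0 < e -> \forall h \near F, \sum_(x <- s) `|(h : l2) x - g x| ^+ 2 <= e ^+ 2.
Proof.
move=> Fg; elim: s e => [|x s IHs] e e0.
  by apply: nearW => h; rewrite big_nil exprn_ge0 ?ltW.
have e2 : 0 < e / 2 by rewrite divr_gt0.
have /cvgrPdist_lt/(_ _ e2) Fx := Fg x.
apply: filterS2 Fx (IHs _ e2) => h hx hs; rewrite big_cons.
apply: (@le_trans _ _ ((e / 2) ^+ 2 + (e / 2) ^+ 2)).
  by rewrite lerD// ler_sqr ?nnegrE ?(ltW e2)// distrC ltW.
rewrite -subr_ge0 (_ : _ - _ = (e / 2) ^+ 2 *+ 2); last by field.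
by rewrite mulrn_wge0// exprn_ge0// ltW.
Qed.

Lemma l2_complete (F : set_system l2) : ProperFilter F -> cauchy F -> cvg F.
Proof.
move=> FF /cauchy_ballP Fc.
have Fcx x : cvg ((fun h : l2 => h x) @ F).
  apply/cauchy_cvgP/cauchy_ballP => e e0; rewrite near_map2.
  have := Fc e e0; rewrite !near_simpl => Fe.
  apply: filterS Fe => -[f h] /=; rewrite -!ball_normE /ball_ /=.
  by apply: le_lt_trans; rewrite -l2BE ler_l2_norm.
pose g x : R[i] := lim ((fun h : l2 => h x) @ F).
have Fg x : (fun h : l2 => h x) @ F --> g x by exact: Fcx.
have key (e : R[i]) : 0 < e -> \forall f \near F, forall A : {fset X},
    \sum_(x <- A) `|(f : l2) x - g x| ^+ 2 <= (2 * e) ^+ 2.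
  move=> e0; have [/= [P Q] [FP FQ] PQ] := Fc e e0.
  apply: filterS FP => f Pf A.
  have [h [hg Qh]] :=
    @filter_ex _ F FF _ (filterI (near_sum_sqr FF (A : seq X) Fg e0) FQ).
  have fh : \sum_(x <- A) `|f x - h x| ^+ 2 <= e ^+ 2.
    rewrite (le_trans (l2_dot_ge_sum (f - h) A))// -l2_normK.
    have := PQ (f, h) (conj Pf Qh); rewrite /= -ball_normE /ball_ /= => fhe.
    by rewrite ler_sqr ?nnegrE ?(ltW e0)// ltW.
  apply: (@le_trans _ _ (2 * (e ^+ 2 + e ^+ 2))); last first.
    by rewrite le_eqVlt; apply/orP; left; apply/eqP; ring.
  apply: (le_trans _ (_ : 2 * (\sum_(x <- A) `|f x - h x| ^+ 2 +
      \sum_(x <- A) `|h x - g x| ^+ 2) <= _)); last first.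
    by rewrite ler_pM2l// lerD.
  rewrite -big_split mulr_sumr; apply: ler_sum => x _ /=.
  by rewrite (le_trans _ (sqr_normD_le _ _))// addrA subrK.
have [f0 f0g] : exists f : l2, forall A : {fset X},
    \sum_(x <- A) `|f x - g x| ^+ 2 <= (2 ^+ 2)%:C%C.
  have [f fg] := @filter_ex _ F FF _ (key 1 ltr01).
  by exists f => A; rewrite rmorphXn /= rmorph_nat (le_trans (fg A))// mulr1.
have gP : square_summable_pred g.
  rewrite (_ : g = (f0 : X -> R[i]) - ((f0 : X -> R[i]) - g)); last first.
    by rewrite subKr.
  apply: rpredB; first exact: l2_funP.
  apply/asboolP/square_summableP; exists (2 ^+ 2) => A; exact: f0g.
apply/cvg_ex; exists (L2 gP); apply/cvgrPdist_lt => e e0.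
have e4 : 0 < e / 4 by rewrite divr_gt0.
pose d := complex.Re (2 * (e / 4)).
have dE : d%:C%C = 2 * (e / 4) by rewrite RRe_real// gtr0_real// mulr_gt0.
have d0 : 0 <= d by rewrite -ler0c dE mulr_ge0// ltW.
near=> f; apply: (@le_lt_trans _ _ d%:C%C); last first.
  rewrite dE -subr_gt0 (_ : _ - _ = e / 2); last by field.
  by rewrite divr_gt0.
rewrite distrC -ler_sqr ?nnegrE ?ler0c// l2_normK -rmorphXn /=.
apply: l2_dot_le => A; rewrite rmorphXn /= dE.
suff : forall A : {fset X},
    \sum_(x <- A) `|f x - g x| ^+ 2 <= (2 * (e / 4)) ^+ 2 by apply.
by near: f; exact: key.
Unshelve. all: by end_near. Qed.

HB.instance Definition _ := Uniform_isComplete.Build l2 l2_complete.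

End l2_space.

HB.instance Definition _ (R : realType) (X : choiceType) :=
  isHilbert.Build R (l2 R X) (@l2_normK R X).

Lemma l2_innerE (R : realType) (X : choiceType) (f g : l2 R X) :
  inner f g = summability.sum (fun x => f x * (g x)^*).
Proof. by []. Qed.

Section finitely_supported.
Variables (R : realType) (X : choiceType).

Lemma l2_basis_subproof (x : X) :
  square_summable_pred (fun y => (x == y)%:R : R[i]).
Proof.
apply/asboolP/square_summableP; exists 1 => A.
have [xA|xA] := boolP (x \in A); last first.
  rewrite big1_seq// => y /= yA; case: eqP => [xy|_].
    by rewrite xy yA in xA.
  by rewrite normr0 expr0n.
rewrite (big_fsetD1 x)//= eqxx normr1 expr1n big1_seq ?addr0//.
move=> y /=; rewrite !inE => /andP[yx _].
by rewrite eq_sym (negPf yx) normr0 expr0n.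
Qed.

Definition l2_basis (x : X) : l2 R X := L2 (l2_basis_subproof x).

Definition lin_span (V : lmodType R[i]) (E : set V) : set V :=
  [set v | exists n (c : 'I_n -> R[i]) (w : 'I_n -> V),
    (forall i, E (w i)) /\ v = \sum_i c i *: w i].

Definition lfin : set (l2 R X) := lin_span (range l2_basis).

Lemma lfin0 : lfin 0.
Proof. by exists 0%N, (fun=> 0), (fun=> 0); split=> [[]//|]; rewrite big_ord0. Qed.

Lemma lfin_linear (a : R[i]) (u v : l2 R X) :
  lfin u -> lfin v -> lfin (a *: u + v).
Proof.
move=> [n [c [w [wE ->]]]] [m [d [t [tE ->]]]].
exists (n + m)%N, (fun i => match fintype.split i with
  inl j => a * c j | inr j => d j end), (fun i => match fintype.split i with
  inl j => w j | inr j => t j end).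
split=> [i|]; first by case: (fintype.split i).
rewrite big_split_ord scaler_sumr; congr (_ + _); apply: eq_bigr => i _.
  have -> : fintype.split (lshift m i) = inl i := unsplitK (inl i).
  by rewrite scalerA.
by have -> : fintype.split (rshift n i) = inr i := unsplitK (inr i).
Qed.

Lemma lfin_supp (u : l2 R X) : lfin u ->
  exists A : {fset X}, forall x, x \notin A -> u x = 0.
Proof.
move=> [n [c [w [wE ->]]]].
have /choice[p pE] : forall i, exists x, l2_basis x = w i.
  by move=> i; case: (wE i) => x; exists x.
exists [fset p i | i : 'I_n]%fset => x xA.
have sumE (I : Type) (r : seq I) (F : I -> l2 R X) :
    (\sum_(i <- r) F i : l2 R X) x = \sum_(i <- r) F i x.
  by apply: (big_morph (fun u : l2 R X => u x)).
rewrite sumE big1// => i _; rewrite -pE l2ZE /=.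
case: eqP => [pix|]; last by rewrite mulr0.
by case/negP: xA; rewrite -pix; apply/imfsetP; exists i.
Qed.

End finitely_supported.

Section operators.
Variable R : realType.

(* A linear operator defined on a subspace op_dom; the values of op_fun outside
   op_dom carry no meaning. *)
Record operator (U V : lmodType R[i]) := Operator {
  op_dom : set U;
  op_fun :> U -> V;
  op_dom0 : op_dom 0;
  op_dom_linear : forall (a : R[i]) u v,
    op_dom u -> op_dom v -> op_dom (a *: u + v);
  op_fun_linear : forall (a : R[i]) u v, op_dom u -> op_dom v ->
    op_fun (a *: u + v) = a *: op_fun u + op_fun v }.

Definition graph (U V : lmodType R[i]) (T : operator U V) : set (U * V) :=
  [set p | op_dom T p.1 /\ T p.1 = p.2].

Definition graph_on (U V : lmodType R[i]) (D : set U) (T : operator U V) :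
  set (U * V) := graph T `&` [set p | D p.1].

(* Closures are taken in the product topology of U * V. *)
Definition closable (U V : hilbertType R) (T : operator U V) : Prop :=
  exists S : operator U V, closure (graph T) = graph S.

Definition is_core (U V : hilbertType R) (D : set U) (B : operator U V) : Prop :=
  [/\ closed (graph B), D `<=` op_dom B & closure (graph_on D B) = graph B].

Definition positive_operator (H : hilbertType R) (B : operator H H) : Prop :=
  forall f, op_dom B f -> 0 <= inner (B f) f.

(* All pairs (g, h) with <Tf, g> = <f, h> on op_dom T: the graph of the adjoint
   when op_dom T is dense. *)
Definition adjoint_graph (U V : hilbertType R) (T : operator U V) :
    set (V * U) :=
  [set p | forall f, op_dom T f -> inner (T f) p.1 = inner f p.2].

Definition self_adjoint (H : hilbertType R) (B : operator H H) : Prop :=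
  dense (op_dom B) /\ graph B = adjoint_graph B.

End operators.

Section kernels.
Variable R : realType.

Definition kernel_on (X : Type) := X -> X -> R[i].

Definition positive_definite (X : Type) (K : kernel_on X) : Prop :=
  forall (n : nat) (x : 'I_n.+1 -> X) (l : 'I_n.+1 -> R[i]),
    0 <= \sum_j \sum_k l j * (l k)^* * K (x j) (x k).

Definition restrict_kernel (X : choiceType) (K : kernel_on X) (A : set X) :
  kernel_on (set_type A) := fun x y => K (val x) (val y).

Definition is_direct_sum (X : choiceType) (S : Type) (Xs : S -> set X)
    (Ks : forall s, kernel_on (set_type (Xs s))) (K : kernel_on X) : Prop :=
  (forall s (x y : set_type (Xs s)), K (val x) (val y) = Ks s x y) /\
  (forall s t x y, Xs s x -> Xs t y -> s <> t -> K x y = 0).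

Variable X : choiceType.
Implicit Types K L : kernel_on X.

Definition l2_kernel K : Prop :=
  forall x, square_summable (K x) /\ square_summable (K^~ x).

(* Total: the value is meaningful when the family is summable, as it is for
   l2-kernels. *)
Definition kernel_mul K L : kernel_on X :=
  fun x z => summability.sum (fun y => K x y * L y z).

Definition kernel_adj K : kernel_on X := fun x y => (K y x)^*.

Definition pdms_root K L : Prop := positive_definite L /\
  forall x z, has_sum (fun y => L x y * L y z) (K x z).

Definition has_pdms_root K : Prop := exists L, pdms_root K L.

Definition factorizes K (H : hilbertType R) (T : operator (l2 R X) H) : Prop :=
  @lfin R X `<=` op_dom T /\
  forall x y, K x y = inner (T (l2_basis R x)) (T (l2_basis R y)).

(* For u in lfin; a bigop over a set such as [set: X] sums the finitely many
   nonzero terms. The order of R[i] makes "<= 1" include being real. *)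
Definition kernel_unit K (u : l2 R X) : Prop :=
  \sum_(x \in [set: X]) \sum_(y \in [set: X]) u x * (u y)^* * K x y <= 1.

(* The Hilbert space of functions with reproducing kernel K, an element being
   identified with a function through the injection rkhs_fun; rkhs_kernel x is
   the element K(x, .). It is unique up to an isometry commuting with
   rkhs_fun. *)
Record rkhs K := RKHS {
  rkhs_space :> hilbertType R;
  rkhs_fun : {linear rkhs_space -> (X -> R[i])};
  rkhs_fun_inj : injective rkhs_fun;
  rkhs_kernel : X -> rkhs_space;
  rkhs_kernelE : forall x, rkhs_fun (rkhs_kernel x) = K x;
  rkhs_repr : forall f x, rkhs_fun f x = inner f (rkhs_kernel x) }.

Arguments rkhs_kernel {K} r x.

Section lfin_operator.
Variables (V : lmodType R[i]) (k : X -> V).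
Implicit Types u v : l2 R X.

Definition lfin_extension (u : l2 R X) : V := \sum_(x \in [set: X]) u x *: k x.

Lemma lfin_extensionE (A : {fset X}) u :
  (forall x, x \notin A -> u x = 0) ->
  lfin_extension u = \sum_(x <- A) u x *: k x.
Proof.
by move=> uA; apply: fsbigTE => x /uA ->; rewrite scale0r.
Qed.

Lemma lfin_extension_linear (a : R[i]) u v : lfin u -> lfin v ->
  lfin_extension (a *: u + v) = a *: lfin_extension u + lfin_extension v.
Proof.
move=> /lfin_supp[A uA] /lfin_supp[B vB].
have uAB x : x \notin (A `|` B)%fset -> u x = 0.
  by rewrite inE negb_or => /andP[/uA].
have vAB x : x \notin (A `|` B)%fset -> v x = 0.
  by rewrite inE negb_or => /andP[_ /vB].
rewrite (lfin_extensionE uAB) (lfin_extensionE vAB).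
rewrite (@lfin_extensionE (A `|` B)%fset); last first.
  by move=> x xAB; rewrite l2DE l2ZE uAB// vAB// mulr0 addr0.
rewrite scaler_sumr -big_split; apply: eq_bigr => x _ /=.
by rewrite scalerA -scalerDl.
Qed.

Definition lfin_operator : operator (l2 R X) V := {|
  op_dom := @lfin R X;
  op_fun := lfin_extension;
  op_dom0 := @lfin0 R X;
  op_dom_linear := @lfin_linear R X;
  op_fun_linear := lfin_extension_linear |}.

Lemma lfin_operator_basis x : lfin_operator (l2_basis R x) = k x.
Proof.
rewrite /= (@lfin_extensionE [fset x]%fset) ?big_seq_fset1.
  by rewrite /= eqxx scale1r.
by move=> y; rewrite inE eq_sym /= => /negPf ->.
Qed.

End lfin_operator.

(* The linear operator on lfin mapping l2_basis x to K(x, .), see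
   lfin_operator_basis. *)
Definition kernel_op K (H : rkhs K) : operator (l2 R X) H :=
  lfin_operator (rkhs_kernel H).

End kernels.

Arguments restrict_kernel {R X} K A.
Arguments is_direct_sum {R X S} Xs Ks K.
Arguments rkhs_fun {R X K} r.
Arguments rkhs_kernel {R X K} r x.
Arguments lfin {R X}.

(* Main.v *)
Require Import Defs.
From HB Require Import structures.
From mathcomp Require Import all_boot all_order all_algebra.
From mathcomp Require Import finmap.
From mathcomp Require Import complex.
From mathcomp Require Import all_classical all_reals.
From mathcomp Require Import ereal topology normedtype sequences esum.
From mathcomp Require Import ring lra.
From mathcomp Require summability.

Set Implicit Arguments.
Unset Strict Implicit.
Unset Printing Implicit Defensive.

Import Order.TTheory GRing.Theory Num.Theory.
Import numFieldNormedType.Exports.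

Local Open Scope classical_set_scope.
Local Open Scope ring_scope.

(** The heart of the matter is that a closable factorization
    [K x y = <T e_x, T e_y>] can be replaced by a positive self-adjoint one, the
    modulus [B] of the closure of [T]; the matrix [<B e_x, e_y>] is then a
    positive definite root of [K], since the Gram matrix of the vectors [B e_x]
    is the square of that matrix.  Everything else is a chain of comparatively
    soft implications closing up through this one.

    The modulus is built without unbounded spectral theory.  A positive definite
    kernel has a feature map [k : X -> l2(X)] ([feature_map_exists]).  Let [G]
    be the closed span of the vectors [g_x = (e_x, k_x)] in
    [l2(X) + l2(X) = l2(X + X)], that is, the closed graph of [e_x |-> k_x], and
    [J] the projection of [G] to the first summand; closability says that [J] is
    injective.  The operator [A = J J^*] plays the role of [(1 + T^* T)^-1];
    both [A] and [1 - A] are positive contractions, and their positive square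
    roots [C] and [S] commute and satisfy [C^2 + S^2 = 1].  The modulus is
    [B = S C^-1]: its graph [{(C h, S h)}] is also the solution set of
    [S f = C g], from which closedness and self-adjointness are immediate.
    Finally [<C u, C v> = <J^* u, J^* v>], so that [C u |-> J^* u] extends to a
    unitary map; pulling the [g_x] back along it gives vectors [h_x] with
    [C h_x = e_x] and [<h_x, h_y> = <g_x, g_y>], whence
    [<B e_x, B e_y> = <k_x, k_y> = K x y], and the [h_x] are total, so that the
    finitely supported vectors form a core ([closable_family_positive]).

    Two tools carry the Hilbert space part: the Riesz representation of a
    bounded functional on the range of a partially defined operator ([riesz]),
    and the principle that limits can be moved between two families with the
    same Gram matrix ([gram_limit]).  Square roots come from an iteration whose
    convergence is dominated by that of a scalar sequence
    ([half_square_fixpoint]).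

    For the remaining conditions, rows of a matrix with square-summable rows and
    columns always form a closable family ([kernel_row_closable]).  A root makes
    the square-summable functions dense in the reproducing kernel space
    ([pdms_root_dense]).  With [T] the kernel operator [e_x |-> K x],
    approximating [K z] by such a function [f] turns [<T v, K z>] into [<v, f>]
    in [l2(X)] up to a small error, which yields the two control conditions, and
    these force the sums along null sequences of unit vectors to tend to zero,
    hence closability again ([weakly_null_closable_family]).  For the
    decomposition, each row of a root has countable support, so the connected
    components of the relation [L x y != 0] are countable
    ([component_partition]); conversely roots of the blocks are glued into a
    square-summable factor ([partition_l2_factor]). *)

(** * Inner products, norms and sequences *)

Section inner_theory.
Variables (R : realType) (H : hilbertType R).
Implicit Types (u v w : H) (a : R[i]).

Lemma innerDl w u v : inner (u + v) w = inner u w + inner v w.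
Proof. exact: linearDl. Qed.
Lemma innerBl w u v : inner (u - v) w = inner u w - inner v w.
Proof. exact: linearBl. Qed.
Lemma innerZl w a u : inner (a *: u) w = a * inner u w.
Proof. exact: linearZl_LR. Qed.
Lemma inner0l w : inner 0 w = 0.
Proof. exact: linear0l. Qed.
Lemma innerDr w u v : inner w (u + v) = inner w u + inner w v.
Proof. exact: linearDr. Qed.
Lemma innerBr w u v : inner w (u - v) = inner w u - inner w v.
Proof. exact: linearBr. Qed.
Lemma innerZr w a u : inner w (a *: u) = a^* * inner w u.
Proof. exact: linearZr_LR. Qed.
Lemma inner0r w : inner w 0 = 0.
Proof. exact: linear0r. Qed.
Lemma inner_conj u v : inner u v = (inner v u)^*.
Proof. by rewrite [LHS]hermC/= expr0 mul1r. Qed.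
Lemma inner_eq0 u : inner u u = 0 -> u = 0.
Proof. by rewrite -normr_inner => /eqP; rewrite sqrf_eq0 normr_eq0 => /eqP. Qed.
Lemma inner_ge0 u : 0 <= inner u u.
Proof. by rewrite -normr_inner exprn_ge0. Qed.
Lemma norm_dot u : `|u| = dot_norm inner u.
Proof.
by apply/eqP; rewrite -(@eqrXn2 _ 2)// ?dot_norm_ge0// dot_normK normr_inner.
Qed.
Lemma inner_CauchySchwarz u v : `|inner u v| <= `|u| * `|v|.
Proof. by rewrite !norm_dot dot_CauchySchwarz. Qed.

Lemma inner_suml (I : Type) (r : seq I) (F : I -> H) w :
  inner (\sum_(i <- r) F i) w = \sum_(i <- r) inner (F i) w.
Proof.
by apply: (big_morph (fun u => inner u w)) => [u v|]; rewrite ?innerDl ?inner0l.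
Qed.
Lemma inner_sumr (I : Type) (r : seq I) (F : I -> H) w :
  inner w (\sum_(i <- r) F i) = \sum_(i <- r) inner w (F i).
Proof.
by apply: (big_morph (fun u => inner w u)) => [u v|]; rewrite ?innerDr ?inner0r.
Qed.

Lemma cvg_innerl (T : Type) (F : set_system T) {FF : Filter F}
    (f : T -> H) u v :
  f @ F --> u -> inner (f x) v @[x --> F] --> inner u v.
Proof.
move=> fu; apply/cvgrPdist_lt => e e0.
have ve0 : 0 < e / (1 + `|v|) by rewrite divr_gt0// ltr_pwDl.
move/cvgrPdist_lt : fu => /(_ _ ve0); apply: filterS => x uf.
rewrite -innerBl (le_lt_trans (inner_CauchySchwarz _ _))//.
move: uf; rewrite ltr_pdivlMr ?ltr_pwDl// => /(le_lt_trans _); apply.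
by rewrite mulrDr mulr1 lerDr.
Qed.

Lemma cvg_innerr (T : Type) (F : set_system T) {FF : Filter F}
    (f : T -> H) u v :
  f @ F --> u -> inner v (f x) @[x --> F] --> inner v u.
Proof.
move=> fu; apply/cvgrPdist_lt => e e0.
have h := @cvg_innerl T F FF f u v fu.
move/cvgrPdist_lt : h => /(_ e e0).
apply: filterS => x; rewrite -innerBl -innerBr.
by rewrite inner_conj norm_conjC.
Qed.

Lemma parallelogram u v :
  `|u - v| ^+ 2 + `|u + v| ^+ 2 = 2 * (`|u| ^+ 2 + `|v| ^+ 2).
Proof.
have expand (a b c d : R[i]) :
  (a - c) - (b - d) + (a + c + (b + d)) = 2 * (a + d) by ring.
by rewrite !normr_inner innerBl !innerBr innerDl !innerDr expand.
Qed.

End inner_theory.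

Section sequences.
Variable R : realType.

Lemma near_invSn_lt (e : R[i]) : 0 < e ->
  \forall n \near \oo, n.+1%:R^-1 < e.
Proof.
move=> e0; have eR := RRe_real (gtr0_real e0).
have e0' : 0 < complex.Re e by rewrite -ltcR eR.
apply: filterS (near_infty_natSinv_lt (PosNum e0')) => n /=.
by rewrite -ltcR eR fmorphV rmorph_nat.
Qed.

Lemma closure_imageP (V : normedModType R[i]) (T : Type) (D : set T)
    (p : T -> V) m :
  closure (p @` D) m <->
  (forall e : R[i], 0 < e -> exists2 u, D u & `|m - p u| < e).
Proof.
split=> [Dm e e0|Dm B /nbhs_normP[e /= e0 eB]].
  have [_ [[u Du <-] /= mu]] := Dm _ (nbhsx_ballx m e e0).
  by exists u => //; move: mu; rewrite -ball_normE.
have [u Du mu] := Dm _ e0.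
by exists (p u); split; [exists u|exact: eB].
Qed.

Lemma closure_image_seq (V : normedModType R[i]) (T : Type) (D : set T)
    (p : T -> V) m : closure (p @` D) m ->
  exists2 u : nat -> T, (forall n, D (u n)) & p (u n) @[n --> \oo] --> m.
Proof.
move=> /closure_imageP Dm.
have /choice[u uP] n : exists u, D u /\ `|m - p u| < n.+1%:R^-1.
  have [|u Du mu] := Dm n.+1%:R^-1; first by rewrite invr_gt0.
  by exists u.
exists u => [n|]; first by case: (uP n).
apply/cvgrPdist_lt => e /near_invSn_lt; apply: filterS => n.
by apply: lt_trans; case: (uP n).
Qed.

Lemma cvg_closure_image (V : normedModType R[i]) (T : Type) (D : set T)
    (p : T -> V) m (u : nat -> T) : (forall n, D (u n)) ->
  p (u n) @[n --> \oo] --> m -> closure (p @` D) m.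
Proof.
move=> uD um B /um[N _ /(_ N (leqnn N)) Bn].
by exists (p (u N)); split => //; exists (u N).
Qed.

Lemma cauchy_seq_cvg (V : completeNormedModType R[i]) (u : nat -> V) :
  (forall e : R[i], 0 < e -> exists N, forall m n, (N <= m)%N -> (N <= n)%N ->
    `|u m - u n| < e) -> exists l : V, u n @[n --> \oo] --> l.
Proof.
move=> uC; apply/cvg_ex/cauchy_cvgP/cauchy_exP => e /uC[N uN].
by exists (u N); exists N => // n /= Nn; rewrite -ball_normE /=; exact: uN.
Qed.

Lemma cvg_cauchy_seq (V : normedModType R[i]) (u : nat -> V) (l : V) :
  u n @[n --> \oo] --> l ->
  forall e : R[i], 0 < e -> exists N, forall m n, (N <= m)%N -> (N <= n)%N ->
    `|u m - u n| < e.
Proof.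
move=> /cvgrPdist_lt ul e e0.
have [|N _ uN] := ul (e / 2); first by rewrite divr_gt0.
exists N => m n /uN um /uN un.
by rewrite (splitr e) -[_ - _](subrKA l) addrC (le_lt_trans (ler_normD _ _))//
  ltrD // distrC.
Qed.

Lemma cvg_unique_norm (V : normedModType R[i]) (T : Type) (F : set_system T)
    {FF : ProperFilter F} (u : T -> V) (l l' : V) :
  u n @[n --> F] --> l -> u n @[n --> F] --> l' -> l = l'.
Proof. by apply: cvg_unique; exact: norm_hausdorff. Qed.

(** Complex form of the discriminant criterion behind every Cauchy-Schwarz
    inequality; [b] may vanish, so it also covers semi-definite forms. *)
Lemma quadratic_discriminant (a b c : R[i]) : 0 <= b ->
  (forall t, 0 <= a + (t * c + (t * c)^*) + `|t| ^+ 2 * b) ->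
  `|c| ^+ 2 <= a * b.
Proof.
move=> b0 q0.
have a0 : 0 <= a.
  by have := q0 0; rewrite !mul0r rmorph0 normr0 expr0n mul0r !addr0.
have key (s : R[i]) : 0 <= s ->
    0 <= a - s * `|c| ^+ 2 *+ 2 + s ^+ 2 * `|c| ^+ 2 * b.
  (* Along this direction the cross term is real and negative. *)
  move=> s0; have := q0 (- (s * c^*)).
  rewrite normrN normrM norm_conjC (ger0_norm s0) exprMn.
  have -> : - (s * c^*) * c = - (s * `|c| ^+ 2) by rewrite normCK; ring.
  rewrite rmorphN rmorphM /= conj_Creal ?ger0_real//.
  by rewrite conj_Creal ?realX ?normr_real// -opprD -mulr2n.
(* When [b = 0] the lower bound is affine in [s] and fails for large [s]
   unless [c = 0]; otherwise [s = 1 / b] minimizes it. *)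
have [bE|bN0] := eqVneq b 0.
  rewrite bE mulr0; apply: contrapT => cN.
  have c0 : 0 < `|c| ^+ 2.
    rewrite lt_neqAle eq_sym exprn_ge0// andbT; apply/eqP => c0.
    by rewrite c0 lexx in cN.
  have := key ((a + 1) / `|c| ^+ 2).
  rewrite bE mulr0 addr0 divfK ?gt_eqF// => /(_ _)/wrap[].
    by rewrite divr_ge0 ?addr_ge0// ltW.
  have -> : a - (a + 1) *+ 2 = - (a + 2) by ring.
  rewrite oppr_ge0 => /(lt_le_trans (_ : 0 < a + 2)).
  by rewrite ltr_wpDl// ltxx => /(_ isT).
have bp : 0 < b by rewrite lt_neqAle eq_sym bN0.
have := key b^-1; rewrite invr_ge0 => /(_ b0).
have -> : a - b^-1 * `|c| ^+ 2 *+ 2 + b^-1 ^+ 2 * `|c| ^+ 2 * b =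
          (a * b - `|c| ^+ 2) / b by field.
by rewrite pmulr_lge0 ?invr_gt0// subr_ge0.
Qed.

Lemma cvg0_of_sqr_le (c : nat -> R[i]) (b : R[i]) : 0 <= b ->
  (forall n, `|c n| ^+ 2 <= n.+1%:R^-1 * b) -> c n @[n --> \oo] --> (0 : R[i]).
Proof.
move=> b0 cb; apply/cvgr0Pnorm_lt => e e0.
have e1 : 0 < e ^+ 2 / (1 + b) by rewrite divr_gt0 ?exprn_gt0// ltr_pwDl.
apply: filterS (near_invSn_lt e1) => n.
rewrite ltr_pdivlMr ?ltr_pwDl// => ne.
rewrite -ltr_sqr ?nnegrE ?(ltW e0)// (le_lt_trans (cb n))//.
by apply: le_lt_trans ne; rewrite mulrDr mulr1 lerDr invr_ge0.
Qed.

End sequences.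

(** * Partially defined operators and the Riesz representation *)

Section operator_theory.
Variables (R : realType) (U : lmodType R[i]) (V : lmodType R[i]).
Variable T : operator U V.
Implicit Types u v : U.

Lemma op_domD u v : op_dom T u -> op_dom T v -> op_dom T (u + v).
Proof. by move=> Tu Tv; rewrite -[u]scale1r; apply: op_dom_linear. Qed.
Lemma op_domZ a u : op_dom T u -> op_dom T (a *: u).
Proof.
move=> Tu; rewrite -[_ *: _]addr0.
by apply: op_dom_linear => //; exact: op_dom0.
Qed.
Lemma op_domB u v : op_dom T u -> op_dom T v -> op_dom T (u - v).
Proof.
by move=> Tu Tv; rewrite -scaleN1r; apply: op_domD => //; apply: op_domZ.
Qed.
Lemma op_funD u v : op_dom T u -> op_dom T v -> T (u + v) = T u + T v.
Proof. by move=> Tu Tv; rewrite -{1}[u]scale1r op_fun_linear// scale1r. Qed.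
Lemma op_fun0 : T 0 = 0.
Proof.
have T0 := op_dom0 T; apply: (addrI (T 0)).
by rewrite -op_funD// !addr0.
Qed.
Lemma op_funZ a u : op_dom T u -> T (a *: u) = a *: T u.
Proof.
move=> Tu; rewrite -[a *: u]addr0 op_fun_linear//; last exact: op_dom0.
by rewrite op_fun0 addr0.
Qed.
Lemma op_funB u v : op_dom T u -> op_dom T v -> T (u - v) = T u - T v.
Proof.
by move=> Tu Tv; rewrite addrC -scaleN1r op_fun_linear// scaleN1r addrC.
Qed.
Definition op_range : set V := T @` op_dom T.
End operator_theory.

Section riesz.
Variables (R : realType) (U : lmodType R[i]) (H : hilbertType R).
Variable T : operator U H.

Section functional.
Variables (f : U -> R[i]) (M : R[i]).
Hypothesis M0 : 0 <= M.
Hypothesis f_linear : forall a u v, op_dom T u -> op_dom T v ->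
  f (a *: u + v) = a * f u + f v.
Hypothesis f_bounded : forall u, op_dom T u -> `|f u| <= M * `|T u|.

Let energy u := `|T u| ^+ 2 - (f u + (f u)^*).

Let energy_real u : (complex.Re (energy u))%:C%C = energy u.
Proof.
apply/RRe_real/realB; first by rewrite realX// normr_real.
by apply/CrealP; rewrite rmorphD /= conjCK addrC.
Qed.

Let energy_ge u : op_dom T u -> - M ^+ 2 <= energy u.
Proof.
move=> Tu; rewrite /energy.
have f2 : f u + (f u)^* <= M * `|T u| *+ 2.
  rewrite (le_trans (real_ler_norm _))//.
    by apply/CrealP; rewrite rmorphD /= conjCK addrC.
  rewrite (le_trans (ler_normD _ _))// norm_conjC -mulr2n lerMn2r.
  by rewrite f_bounded ?orbT.
rewrite -subr_ge0 opprK.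
apply: (@le_trans _ _ ((`|T u| - M) ^+ 2)).
  by rewrite real_exprn_even_ge0// realB ?ger0_real.
rewrite sqrrB [M * _]mulrC in f2 *.
by rewrite lerD2r lerD2l lerN2.
Qed.

Let energy_inf : exists c : R[i],
  (forall u, op_dom T u -> c <= energy u) /\
  (forall e : R[i], 0 < e -> exists2 u, op_dom T u & energy u < c + e).
Proof.
pose E := (fun u => complex.Re (energy u)) @` op_dom T.
have MR : M ^+ 2 = (complex.Re (M ^+ 2))%:C%C.
  by rewrite RRe_real// realX// ger0_real.
have Ei : has_inf E.
  split; first by exists (complex.Re (energy 0)), 0 => //; exact: op_dom0.
  exists (- complex.Re (M ^+ 2)) => _ [u Tu <-].
  by rewrite -lecR rmorphN /= -MR energy_real energy_ge.
exists (inf E)%:C%C; split=> [u Tu|e e0].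
  by rewrite -energy_real lecR; apply: (ge_inf Ei.2); exists u.
have eR := RRe_real (gtr0_real e0).
have [|_ [u Tu <-] ue] := @inf_adherent _ _ (complex.Re e) _ Ei.
  by rewrite -ltcR eR.
by exists u => //; rewrite -energy_real -eR -rmorphD ltcR.
Qed.

(** Minimizes the energy [|T u|^2 - 2 Re (f u)], which is bounded below
    because [f] is bounded by [T]. The functional lives on the domain and not
    on the range, so that it need not be checked to factor through [T]; the
    representing vector is a limit of values of [T], hence unique. *)
Lemma riesz : exists2 m : H, closure (op_range T) m &
  forall u, op_dom T u -> f u = inner (T u) m.
Proof.
have [c [c_le c_inf]] := energy_inf.
have /choice[u uP] n : exists u, op_dom T u /\ energy u < c + n.+1%:R^-1.
  have [|u Tu mu] := c_inf n.+1%:R^-1; first by rewrite invr_gt0.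
  by exists u.
have Du n : op_dom T (u n) by case: (uP n).
have energyD v w (t : R[i]) : op_dom T v -> op_dom T w ->
    energy (t *: v + w) = energy w + (t * (inner (T v) (T w) - f v) +
      (t * (inner (T v) (T w) - f v))^*) + `|t| ^+ 2 * `|T v| ^+ 2.
  move=> Tv Tw; rewrite /energy op_fun_linear// f_linear//.
  rewrite !normr_inner innerDl !innerDr !innerZl !innerZr (inner_conj (T w)).
  rewrite normCK !rmorphM !rmorphB !rmorphD !rmorphM /=.
  set a := inner _ _; set b := inner _ _; set d := inner _ _.
  suff: forall a b d t x y: R[i], t * (t^* * a) + t * b + (t^* * b^* + d) -
  (t * x + y + (t^* * x^* + y^*)) =
  d - (y + y^*) + (t * (b - x) + t^* * (b^* - x^*)) + t * t^* * a by apply.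
  by move=> *; ring.
(* The parallelogram identity makes minimizing sequences Cauchy. *)
have energy_mid v w : op_dom T v -> op_dom T w ->
    `|T v - T w| ^+ 2 <= 2 * (energy v + energy w - (c + c)).
  move=> Tv Tw.
  have Tvw : op_dom T (2^-1 *: (v + w)) by exact/op_domZ/op_domD.
  have := c_le _ Tvw; rewrite /energy op_funZ ?op_funD//; last exact: op_domD.
  have -> : f (2^-1 *: (v + w)) = 2^-1 * (f v + f w).
    rewrite -[_ *: _]addr0 f_linear; [|exact: op_domD|exact: op_dom0].
    have f0 : f 0 = 0.
      have T0 := op_dom0 T; have := f_linear 1 T0 T0.
      by rewrite scaler0 addr0 mul1r => /esym/(canRL (addrK _)); rewrite subrr.
    by rewrite f0 addr0 -{1}[v]scale1r f_linear// mul1r.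
  have := parallelogram (T v) (T w).
  rewrite normrZ exprMn normfV ger0_norm// rmorphM rmorphD /=.
  rewrite fmorphV rmorph_nat.
  move=> /(canRL (addrK _)) ->.
  set p := `|T v + T w| ^+ 2; move=> cp.
  rewrite -subr_ge0.
  have -> : 2 * (`|T v| ^+ 2 - (f v + (f v)^*) +
      (`|T w| ^+ 2 - (f w + (f w)^*)) - (c + c)) -
     (2 * (`|T v| ^+ 2 + `|T w| ^+ 2) - p) =
     4 * (2^-1 ^+ 2 * p -
       (2^-1 * (f v + f w) + 2^-1 * ((f v)^* + (f w)^*)) - c).
    by field.
  by rewrite mulr_ge0// subr_ge0.
have [|m Tum] := @cauchy_seq_cvg _ _ (T \o u).
  move=> e e0; have e2 : 0 < e ^+ 2 / 4 by rewrite divr_gt0 ?exprn_gt0.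
  have [N _ Ne] := near_invSn_lt e2.
  exists N => i j /Ne Ni /Ne Nj; rewrite -ltr_sqr ?nnegrE ?(ltW e0)//=.
  rewrite (le_lt_trans (energy_mid _ _ _ _))//.
  have ui : energy (u i) - c < e ^+ 2 / 4.
    by rewrite ltrBlDl (lt_trans (uP i).2)// ltrD2l.
  have uj : energy (u j) - c < e ^+ 2 / 4.
    by rewrite ltrBlDl (lt_trans (uP j).2)// ltrD2l.
  rewrite opprD addrACA.
  have -> : e ^+ 2 = 2 * (e ^+ 2 / 4 + e ^+ 2 / 4) by field.
  by rewrite ltr_pM2l// ltrD.
exists m; first exact: cvg_closure_image Du Tum.
move=> v Tv; apply/eqP; rewrite eq_sym -subr_eq0; apply/eqP.
have b0 : 0 <= `|T v| ^+ 2 by rewrite exprn_ge0.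
apply: (@cvg_unique_norm _ _ _ \oo _ (fun n => inner (T v) (T (u n)) - f v)).
  by apply: cvgB; [exact: cvg_innerr|exact: cvg_cst].
(* First-order condition: an almost minimizer almost represents [f]. *)
apply: (cvg0_of_sqr_le b0) => n.
apply: (@le_trans _ _ ((energy (u n) - c) * `|T v| ^+ 2)).
  apply: quadratic_discriminant => // t.
  have := c_le _ (op_dom_linear t Tv (Du n)); rewrite energyD// -subr_ge0.
  congr (0 <= _); set z := t * _; ring.
by rewrite ler_wpM2r// lerBlDl ltW//; case: (uP n).
Qed.
End functional.
End riesz.

(** * Closed ranges and families with equal Gram matrices *)

Section closed_range.
Variables (R : realType) (U : lmodType R[i]) (H : hilbertType R).
Variable T : operator U H.

Lemma closure_range_fun u : op_dom T u -> closure (op_range T) (T u).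
Proof. by move=> Tu; apply: subset_closure; exists u. Qed.

Lemma closure_range_inner m w w' : closure (op_range T) m ->
  (forall u, op_dom T u -> inner (T u) w = inner (T u) w') ->
  inner m w = inner m w'.
Proof.
move=> /closure_image_seq[u Du um] ww'.
apply: cvg_unique_norm (cvg_innerl (v := w) um) _.
by under eq_fun do rewrite ww'//; exact: cvg_innerl.
Qed.

Lemma closure_range_linear a m m' : closure (op_range T) m ->
  closure (op_range T) m' -> closure (op_range T) (a *: m + m').
Proof.
move=> /closure_image_seq[u Du um] /closure_image_seq[u' Du' um'].
apply: (@cvg_closure_image _ _ _ _ T _ (fun n => a *: u n + u' n)).
  by move=> n; exact: op_dom_linear.
under eq_fun do rewrite op_fun_linear//.
by apply: cvgD => //; exact: cvgZr.
Qed.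

Lemma closure_range_eq m m' : closure (op_range T) m ->
  closure (op_range T) m' ->
  (forall u, op_dom T u -> inner (T u) m = inner (T u) m') -> m = m'.
Proof.
move=> cm cm' mm'; apply/eqP; rewrite -subr_eq0; apply/eqP/inner_eq0.
have := closure_range_inner (closure_range_linear (a := - 1) cm' cm) mm'.
by rewrite scaleN1r addrC innerBr => ->; rewrite subrr.
Qed.

(** Orthogonal projection onto the closed range, as the representing vector of
    the functional [<., h>]. *)
Lemma projection h : exists2 m, closure (op_range T) m &
  forall u, op_dom T u -> inner (T u) h = inner (T u) m.
Proof.
apply: (@riesz _ _ _ T (fun u => inner (T u) h) `|h|) => // [a u v Tu Tv|u _].
  by rewrite op_fun_linear// innerDl innerZl.
by rewrite (le_trans (inner_CauchySchwarz _ _))// mulrC.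
Qed.

Lemma total_closure_range :
  (forall h, (forall u, op_dom T u -> inner (T u) h = 0) -> h = 0) ->
  forall h, closure (op_range T) h.
Proof.
move=> T_total h; have [m Tm mh] := projection h.
suff -> : h = m by [].
apply/eqP; rewrite -subr_eq0; apply/eqP/T_total => u Tu.
by rewrite innerBr mh// subrr.
Qed.
End closed_range.

(** Equal Gram matrices give an isometry from the closed range of [T] into
    that of [T']. It sends [m] to [m'] and is recorded here by its effect on
    all pairs [(z, z')] that are tested in the same way by both families; such
    pairs include [(T v, T' v)] and the pairs produced by the lemma itself. *)
Lemma gram_limit (R : realType) (U : lmodType R[i]) (H H' : hilbertType R)
    (T : operator U H) (T' : operator U H') m :
  op_dom T `<=` op_dom T' ->
  (forall u v, op_dom T u -> op_dom T v ->
    inner (T u) (T v) = inner (T' u) (T' v)) ->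
  closure (op_range T) m ->
  exists2 m', closure (op_range T') m' &
    forall z z', (forall u, op_dom T u -> inner (T u) z = inner (T' u) z') ->
      inner m z = inner m' z'.
Proof.
move=> TT' gramE /closure_image_seq[u Du um].
have [|m' um'] := @cauchy_seq_cvg _ _ (T' \o u).
  move=> e e0; have [N uN] := cvg_cauchy_seq um e0.
  exists N => i j Ni Nj; apply: le_lt_trans (uN i j Ni Nj) => /=.
  rewrite -!op_funB//; try exact: TT'.
  rewrite -ler_sqr ?nnegrE// !normr_inner gramE//; exact: op_domB.
exists m'.
  by apply: (@cvg_closure_image _ _ _ _ T' _ u) => // n; exact: TT'.
move=> z z' zz'; apply: cvg_unique_norm (cvg_innerl (v := z) um) _.
by under eq_fun do rewrite zz'//; exact: cvg_innerl.
Qed.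

Section total_operator.
Variables (R : realType) (U V : lmodType R[i]) (f : U -> V).
Hypothesis f_linear : forall a u v, f (a *: u + v) = a *: f u + f v.
Definition total_operator : operator U V := {|
  op_dom := [set: U]; op_fun := f;
  op_dom0 := I; op_dom_linear := fun _ _ _ _ _ => I;
  op_fun_linear := fun a u v _ _ => f_linear a u v |}.
End total_operator.

(** * Finitely supported vectors *)

Section lfin_theory.
Variables (R : realType) (X : choiceType).
Implicit Types (u v : l2 R X) (x : X).
Local Notation e_ := (@l2_basis R X).

Lemma lfin_basis x : lfin (e_ x).
Proof.
exists 1%N, (fun=> 1), (fun=> e_ x); split; first by move=> _; exists x.
by rewrite big_ord1 scale1r.
Qed.

Lemma lfin_ind (P : l2 R X -> Prop) : P 0 ->
  (forall a x v, lfin v -> P v -> P (a *: e_ x + v)) ->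
  forall u, lfin u -> P u.
Proof.
move=> P0 PD u [n [c [w [we ->]]]].
suff [] : lfin (\sum_(i < n) c i *: w i) /\ P (\sum_(i < n) c i *: w i) by [].
elim: n c w we => [|n IHn] c w we.
  by rewrite big_ord0; split=> //; exact: lfin0.
rewrite big_ord_recl.
have [L PL] := IHn (c \o lift ord0) (w \o lift ord0) (fun i => we _).
by have [x _ <-] := we ord0; split; [exact/lfin_linear/L/lfin_basis|exact: PD].
Qed.

Lemma inner_basisr u x : inner u (e_ x) = u x.
Proof.
rewrite l2_innerE; apply: sum_has_sum; apply/has_sumP => d d0.
exists [fset x]%fset => B; rewrite fsub1set => xB.
rewrite (big_fsetD1 x)//= eqxx rmorph1 mulr1 big1_seq ?addr0 ?subrr ?normr0//.
move=> y /=; rewrite !inE => /andP[yx _].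
by rewrite eq_sym (negPf yx) rmorph0 mulr0.
Qed.

Lemma inner_basisl u x : inner (e_ x) u = (u x)^*.
Proof. by rewrite inner_conj inner_basisr. Qed.

Lemma inner_basis x y : inner (e_ x) (e_ y) = (x == y)%:R.
Proof. by rewrite inner_basisr. Qed.

Lemma lfin_op_eq (V : lmodType R[i]) (T T' : operator (l2 R X) V) :
  lfin `<=` op_dom T -> lfin `<=` op_dom T' ->
  (forall x, T (e_ x) = T' (e_ x)) -> forall u, lfin u -> T u = T' u.
Proof.
move=> TD TD' TT'; apply: lfin_ind => [|a x v v_fin vE].
  by rewrite !op_fun0.
by rewrite !op_fun_linear ?vE ?TT'//;
  solve [apply: TD => //; exact: lfin_basis|
         apply: TD' => //; exact: lfin_basis].
Qed.

Lemma lfin_operatorE (V : lmodType R[i]) (T : operator (l2 R X) V) u :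
  lfin `<=` op_dom T -> lfin u ->
  T u = lfin_operator (fun x => T (e_ x)) u.
Proof.
by move=> TD; apply: lfin_op_eq => // x; rewrite lfin_operator_basis.
Qed.

Lemma lfin_operator_id u : lfin u -> lfin_operator e_ u = u.
Proof.
move: u; apply: lfin_ind => [|a x v vf vE]; rewrite ?op_fun0//.
by rewrite op_fun_linear ?vE ?lfin_operator_basis//; exact: lfin_basis.
Qed.

Lemma lfin_gram (H H' : hilbertType R) (k : X -> H) (k' : X -> H')
    (z : H) (z' : H') : (forall x, inner (k x) z = inner (k' x) z') ->
  forall u, lfin u ->
    inner (lfin_operator k u) z = inner (lfin_operator k' u) z'.
Proof.
move=> kk'; apply: lfin_ind => [|a x v vf vE].
  by rewrite !op_fun0 !inner0l.
rewrite !op_fun_linear ?lfin_operator_basis//; try exact: lfin_basis.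
by rewrite !innerDl !innerZl kk' vE.
Qed.

Lemma lfin_gram2 (H H' : hilbertType R) (k : X -> H) (k' : X -> H') :
  (forall x y, inner (k x) (k y) = inner (k' x) (k' y)) ->
  forall u v, lfin u -> lfin v ->
  inner (lfin_operator k u) (lfin_operator k v) =
  inner (lfin_operator k' u) (lfin_operator k' v).
Proof.
move=> kk' u v uf vf; apply: lfin_gram => // x.
rewrite inner_conj [RHS]inner_conj; congr (_^*).
by apply: lfin_gram => // y.
Qed.

Lemma lfin_sum (V : lmodType R[i]) (k : X -> V) u (A : {fset X}) :
  (forall x, x \notin A -> u x = 0) ->
  lfin_operator k u = \sum_(x <- A) u x *: k x.
Proof. exact: lfin_extensionE. Qed.

(** The basis vectors are total. *)
Lemma lfin_approx u (e : R[i]) : 0 < e -> exists2 v, lfin v & `|u - v| < e.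
Proof.
move=> e0; have e_total : closure (op_range (lfin_operator e_)) u.
  apply: total_closure_range => g g0; apply: l2P => x.
  rewrite -inner_basisr inner_conj -(lfin_operator_basis e_ x) g0 ?rmorph0//.
  exact: lfin_basis.
have [v vf uv] := (closure_imageP _ _ _).1 e_total _ e0.
by exists v => //; rewrite -(lfin_operator_id vf).
Qed.
End lfin_theory.

(** * Feature maps of positive definite kernels *)

Section positive_definite.
Variables (R : realType) (X : choiceType) (K : X -> X -> R[i]).
Hypothesis K_pd : positive_definite K.

Lemma pd_seq (s : seq X) (u : X -> R[i]) :
  0 <= \sum_(x <- s) \sum_(y <- s) u x * (u y)^* * K x y.
Proof.
case: s => [|x0 s]; first by rewrite big_nil.
rewrite (big_nth x0) big_mkord.
under eq_bigr do rewrite (big_nth x0) big_mkord.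
exact: (K_pd (fun i => nth x0 (x0 :: s) i) (fun i => u (nth x0 (x0 :: s) i))).
Qed.

Lemma pd_diag x : 0 <= K x x.
Proof.
have := pd_seq [:: x] (fun=> 1).
by rewrite !big_seq1 rmorph1 !mul1r.
Qed.

(** [t^* K x y + t K y x] is a difference of nonnegative numbers, hence real;
    comparing it with its conjugate at [t = 1] and [t = i] gives the claim. *)
Lemma pd_hermitian x y : K y x = (K x y)^*.
Proof.
have h (t : R[i]) : t^* * K x y + t * K y x \is Num.real.
  have := K_pd (fun i : 'I_2 => if i == 0 then x else y)
    (fun i : 'I_2 => if i == 0 then 1 else t).
  rewrite !big_ord_recl !big_ord0 /= !rmorph1 !mul1r !addr0 !mulr1 => h.
  have -> : t^* * K x y + t * K y x =
    K x x + t^* * K x y + (t * K y x + t * t^* * K y y)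
      - (K x x + `|t| ^+ 2 * K y y) by rewrite normCK; ring.
  rewrite realB ?ger0_real//.
  by rewrite addr_ge0 ?mulr_ge0 ?exprn_ge0 ?pd_diag.
have /CrealP := h 1; have /CrealP := h 'i%C.
rewrite !(rmorphD, rmorphM) /= !conjCK rmorph1 !mul1r.
have i0 : 'i%C != 0 :> R[i] by rewrite eq_complex /= eqxx oner_eq0.
have -> : 'i%C^* = - 'i%C :> R[i].
  by apply/eqP; rewrite eq_complex /= oppr0 !eqxx.
set a := K x y; set b := K y x => h1 h2.
have {}h1 : a^* - b^* = b - a.
  by apply: (mulfI i0); rewrite mulrBr -mulNr h1; ring.
have n2 : (2 : R[i]) != 0 by rewrite pnatr_eq0.
apply: (mulfI n2).
have -> : 2 * b = (b - a) + (a + b) by ring.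
by rewrite -h1 -h2; ring.
Qed.

(** Positivity on the vector [e_x0 + t u]: the quadratic inequality that
    bounds the functional [u |-> sum u x K x x0] by the form of [K]. *)
Lemma pd_bordered (S : {fset X}) x0 (u : X -> R[i]) (t : R[i]) : x0 \notin S ->
  0 <= `|t| ^+ 2 * (\sum_(x <- S) \sum_(y <- S) u x * (u y)^* * K x y)
    + (t * (\sum_(x <- S) u x * K x x0) + (t * (\sum_(x <- S) u x * K x x0))^*)
    + K x0 x0.
Proof.
move=> x0S; pose w x := if x == x0 then 1 else t * u x.
have wS x : x \in S -> w x = t * u x.
  by move=> xS; rewrite /w; case: eqP => // xE; rewrite -xE xS in x0S.
have := pd_seq (x0 |` S)%fset w.
rewrite !big_fsetU1//=.
under [X in _ + X]eq_bigr do rewrite big_fsetU1//=.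
rewrite big_split/= {1 2}/w eqxx rmorph1 !mul1r.
congr (0 <= _).
have -> : \sum_(y <- S) w x0 * (w y)^* * K x0 y =
    (t * (\sum_(x <- S) u x * K x x0))^*.
  rewrite rmorphM rmorph_sum mulr_sumr; apply: eq_big_seq => y yS.
  by rewrite (wS y)// /w eqxx mul1r [K x0 y]pd_hermitian !rmorphM mulrA.
have -> : \sum_(x <- S) w x * (w x0)^* * K x x0 =
    t * (\sum_(x <- S) u x * K x x0).
  rewrite mulr_sumr; apply: eq_big_seq => x xS.
  by rewrite (wS x)// /w eqxx rmorph1 mulr1 mulrA.
have -> : \sum_(x <- S) \sum_(y <- S) w x * (w y)^* * K x y =
  `|t| ^+ 2 * (\sum_(x <- S) \sum_(y <- S) u x * (u y)^* * K x y).
  rewrite mulr_sumr; apply: eq_big_seq => x xS.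
  rewrite mulr_sumr; apply: eq_big_seq => y yS.
  by rewrite !wS// normCK rmorphM; ring.
rewrite addrAC [RHS]addrC; ring.
Qed.

End positive_definite.

Section feature_map.
Variables (R : realType) (X : choiceType) (K : X -> X -> R[i]).
Hypothesis K_pd : positive_definite K.

Section extension.
Variables (A : set X) (k : X -> l2 R X) (x0 : X).
Hypothesis kK : forall x y, A x -> A y -> inner (k x) (k y) = K x y.
Hypothesis k_supp : forall x y, A x -> ~ A y -> k x y = 0.
Hypothesis x0A : ~ A x0.

Let D : set (l2 R X) := [set u | lfin u /\ forall x, ~ A x -> u x = 0].

Let D0 : D 0. Proof. by split; first exact: lfin0. Qed.

Let D_linear (a : R[i]) u v : D u -> D v -> D (a *: u + v).
Proof.
move=> [uf uA] [vf vA]; split; first exact: lfin_linear.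
by move=> x xA; rewrite l2DE l2ZE uA// vA// mulr0 addr0.
Qed.

Let T_linear (a : R[i]) u v : D u -> D v ->
  lfin_extension k (a *: u + v) = a *: lfin_extension k u + lfin_extension k v.
Proof. by move=> [uf _] [vf _]; exact: lfin_extension_linear. Qed.

Let T : operator (l2 R X) (l2 R X) := Operator D0 D_linear T_linear.

Let f (u : l2 R X) : R[i] := lfin_extension (fun x => K x x0 : R[i]^o) u.

Let f_linear (a : R[i]) u v : D u -> D v -> f (a *: u + v) = a * f u + f v.
Proof. by move=> [uf _] [vf _]; exact: lfin_extension_linear. Qed.

Let bordered u (t : R[i]) : D u ->
  0 <= `|t| ^+ 2 * `|T u| ^+ 2 + (t * f u + (t * f u)^*) + K x0 x0.
Proof.
move=> [uf uA]; have [S uS] := lfin_supp uf.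
have uS' x : x \notin (S `\ x0)%fset -> u x = 0.
  rewrite !inE negb_and negbK => /orP[/eqP ->|/uS//]; exact: uA.
have := @pd_bordered _ _ _ K_pd (S `\ x0)%fset x0 u t.
rewrite !inE eqxx/= => /(_ isT).
congr (0 <= _ + _ + _); last first.
  by rewrite /f (lfin_extensionE _ uS').
congr (_ * _); rewrite normr_inner /T/= (lfin_extensionE _ uS').
rewrite inner_suml; apply: eq_bigr => x _; rewrite inner_sumr.
apply: eq_bigr => y _; rewrite innerZl innerZr mulrA.
have [Ax|/uA ->] := pselect (A x); last by rewrite !mul0r.
have [Ay|/uA ->] := pselect (A y); last by rewrite rmorph0 mulr0 !mul0r.
by rewrite kK.
Qed.

(** One step of a transfinite Gram-Schmidt construction: the new vector is the
    Riesz representation [m] of the prescribed inner products, plus a multiple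
    of the unused basis vector [e_x0] restoring the prescribed norm. *)
Lemma feature_extend : exists w : l2 R X,
  [/\ forall x, A x -> inner (k x) w = K x x0, inner w w = K x0 x0 &
    forall y, ~ A y -> y <> x0 -> w y = 0].
Proof.
have K0 := pd_diag K_pd x0.
have [||m mT fm] := @riesz _ _ _ T f (sqrtC (K x0 x0)) _ f_linear.
- by rewrite sqrtC_ge0.
- move=> u Du; rewrite -ler_sqr ?nnegrE ?mulr_ge0 ?sqrtC_ge0//.
  rewrite exprMn sqrtCK; apply: quadratic_discriminant => [|t].
    by rewrite exprn_ge0.
  have := bordered t Du; congr (0 <= _); rewrite addrC -[RHS]addrA.
  by congr (_ + _); exact: addrC.
have kT x : A x -> D (l2_basis R x) /\ T (l2_basis R x) = k x.
  move=> Ax; split; last exact: lfin_operator_basis.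
  split=> [|y yA]; first exact: lfin_basis.
  by rewrite /=; case: eqP => // xy; rewrite xy in Ax.
have m_supp y : ~ A y -> m y = 0.
  move=> yA; rewrite -inner_basisr -(inner0r m).
  apply: (closure_range_inner mT) => u [uf uA]; rewrite inner0r.
  have [S uS] := lfin_supp uf; rewrite /T/= (lfin_extensionE _ uS) inner_suml.
  apply: big1 => x _; rewrite innerZl inner_basisr.
  have [Ax|/uA ->] := pselect (A x); last by rewrite mul0r.
  by rewrite k_supp// mulr0.
(* This is the positivity of [K] on [e_x0 - u], for [T u] close to [m]. *)
have m_le : `|m| ^+ 2 <= K x0 x0.
  apply/ler_addgt0Pr => e e0.
  have e1 : 0 < sqrtC e by rewrite sqrtC_gt0.
  have [u Du mu] := (closure_imageP _ _ _).1 mT _ e1.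
  have mue : `|m - T u| ^+ 2 <= e.
    by rewrite -[leRHS]sqrtCK ler_sqr ?nnegrE ?(ltW e1)// ltW.
  rewrite -lerBlDr; apply: le_trans (lerB (lexx _) mue) _.
  rewrite -subr_ge0; have := bordered (- 1) Du; congr (0 <= _).
  have -> : (- 1 * f u)^* = - inner m (T u).
    by rewrite mulN1r rmorphN fm// [inner m _]inner_conj.
  rewrite fm// normrN normr1 expr1n mul1r !normr_inner innerBl !innerBr.
  move: (inner (T u) (T u)) (inner m m) => a b.
  move: (inner (T u) m) (inner m (T u)) => c d.
  ring.
pose d := sqrtC (K x0 x0 - `|m| ^+ 2).
exists (m + d *: l2_basis R x0); split.
- move=> x Ax; have [De <-] := kT x Ax.
  rewrite innerDr innerZr -fm// inner_basisr.
  have -> : T (l2_basis R x) x0 = 0 by rewrite (kT x Ax).2 k_supp.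
  rewrite mulr0 addr0 /f (@lfin_extensionE _ _ _ _ [fset x]%fset).
    by rewrite big_seq_fset1 /= eqxx scale1r.
  by move=> y; rewrite inE eq_sym /= => /negPf ->.
- rewrite innerDl !innerDr !innerZl !innerZr.
  rewrite inner_basisr inner_basisl inner_basis eqxx.
  rewrite m_supp// rmorph0 !mulr0 addr0 add0r mulr1.
  rewrite conj_Creal ?ger0_real ?sqrtC_ge0 ?subr_ge0// -expr2 sqrtCK.
  by rewrite normr_inner addrC subrK.
- move=> y yA /eqP yx; rewrite l2DE l2ZE m_supp//= eq_sym (negPf yx).
  by rewrite mulr0 addr0.
Qed.
End extension.

(** Zorn's lemma on partial feature maps, encoded by their graphs: the values
    attached to [x] must be vectors supported in the domain, which keeps a
    fresh basis vector available for each new point. Functionality of the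
    graph is automatic, since two values at [x] have equal inner products with
    both. *)
Lemma feature_map_exists : exists k : X -> l2 R X,
  forall x y, inner (k x) (k y) = K x y.
Proof.
pose dom (G : set (X * l2 R X)) x := exists v, G (x, v).
pose P (G : set (X * l2 R X)) :=
  (forall p q, G p -> G q -> inner p.2 q.2 = K p.1 q.1) /\
  (forall p x, G p -> ~ dom G x -> p.2 x = 0).
have [|G [[GK Gsupp] Gmax]] := @Zorn_bigcup _ P.
  move=> F FP Ftot; split=> [p q [G FG Gp] [G' FG' G'q]|p x [G FG Gp] xF].
    have [GG'|G'G] := Ftot _ _ FG FG'.
      by apply: (FP _ FG').1 => //; exact: GG'.
    by apply: (FP _ FG).1 => //; exact: G'G.
  apply: (FP _ FG).2 => // -[v Gxv]; apply: xF.
  by exists v; exists G.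
have /choice[k kG] x : exists v, dom G x -> G (x, v).
  have [[v Gv]|xG] := pselect (dom G x); first by exists v.
  by exists 0.
exists k.
suff Gall x : dom G x.
  by move=> x y; apply: (GK (x, k x) (y, k y)); exact: kG.
apply: contrapT => xG.
have [y z /kG Gy /kG Gz|y z /kG Gy zG||w [kw ww w_supp]] :=
  @feature_extend (dom G) k x.
- exact: (GK _ _ Gy Gz).
- exact: (Gsupp _ _ Gy).
- by [].
have kE y v : G (y, v) -> v = k y.
  move=> Gv; have Gk : G (y, k y) by apply: kG; exists v.
  apply/eqP; rewrite -subr_eq0; apply/eqP/inner_eq0.
  rewrite innerBl !innerBr (GK _ _ Gv Gv) (GK _ _ Gv Gk) (GK _ _ Gk Gv).
  by rewrite (GK _ _ Gk Gk) /= !subrr.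
apply: (Gmax (G `|` [set (x, w)])).
  split; first by move=> p Gp; left.
  by move=> /(_ (x, w) (or_intror erefl)) Gw; apply: xG; exists w.
split=> [[y v] [z v'] [Gy|[-> ->]] [Gz|[-> ->]]|[y v] z [Gy|[-> ->]] zG] //=.
- exact: (GK _ _ Gy Gz).
- by rewrite (kE _ _ Gy) kw//; exists v.
- rewrite inner_conj (kE _ _ Gz) kw; last by exists v'.
  by rewrite -pd_hermitian.
- by apply: (Gsupp _ _ Gy) => -[u Gu]; apply: zG; exists u; left.
- apply: w_supp => [[u Gu]|zx]; first by apply: zG; exists u; left.
  by apply: zG; exists w; right; rewrite zx.
Qed.
End feature_map.

(** * Reproducing kernel Hilbert spaces *)

Section orthogonal_complement.
Variables (R : realType) (H : hilbertType R) (E : set H).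

(** The orthogonal complement of any set is a Hilbert space; closed spans are
    obtained as double complements. *)
Definition orthogonal_pred : {pred H} :=
  fun v => `[< forall w, E w -> inner v w = 0 >].

Lemma orthogonal_submod_closed : submod_closed orthogonal_pred.
Proof.
split=> [|a u v /asboolP uE /asboolP vE]; apply/asboolP => w Ew.
  by rewrite inner0l.
by rewrite innerDl innerZl uE// vE// mulr0 addr0.
Qed.

HB.instance Definition _ := GRing.isSubmodClosed.Build R[i] H
  orthogonal_pred orthogonal_submod_closed.

Record orthogonal := Orthogonal {
  orthogonal_val :> H;
  orthogonal_valP : orthogonal_pred orthogonal_val }.

HB.instance Definition _ := [isSub for orthogonal_val].
HB.instance Definition _ := [Choice of orthogonal by <:].
HB.instance Definition _ := [SubChoice_isSubLmodule of orthogonal by <:].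

Implicit Types u v w : orthogonal.

Definition orthogonal_dot u v : R[i] := inner (u : H) (v : H).

Lemma orthogonal_dot_hermitian u v :
  orthogonal_dot u v = (-1) ^+ false * (orthogonal_dot v u)^*.
Proof. by rewrite expr0 mul1r; exact: inner_conj. Qed.

Lemma orthogonal_dot_bilinear : bilinear_for
  (GRing.Scale.Law.clone _ _ *%R _)
  (GRing.Scale.Law.clone _ _ (Num.conj \; *%R) _) orthogonal_dot.
Proof.
split=> [w|w] a u v /=; rewrite /orthogonal_dot.
  by rewrite innerDl innerZl.
by rewrite innerDr innerZr.
Qed.

HB.instance Definition _ := bilinear_isBilinear.Build R[i] orthogonal
  orthogonal R[i] (GRing.Scale.Law.clone _ _ *%R _)
  (GRing.Scale.Law.clone _ _ (Num.conj \; *%R) _) orthogonal_dot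
  orthogonal_dot_bilinear.

HB.instance Definition _ := @isHermitianSesquilinear.Build R[i] orthogonal
  false Num.conj orthogonal_dot orthogonal_dot_hermitian.

Lemma orthogonal_dot_gt0 u : u != 0 -> 0 < orthogonal_dot u u.
Proof.
move=> u0; rewrite /orthogonal_dot lt_neqAle inner_ge0 andbT eq_sym.
apply: contra u0 => /eqP/inner_eq0 u0; exact/eqP/val_inj.
Qed.

HB.instance Definition _ := isDotProduct.Build R[i] orthogonal orthogonal_dot
  orthogonal_dot_gt0.

HB.instance Definition _ := Lmodule_isNormed.Build R[i] orthogonal
  (ler_dot_normD orthogonal_dot) (dot_normZ orthogonal_dot)
  (@dot_norm0_eq0 _ _ orthogonal_dot).

Lemma orthogonal_normE u : `|u| = `|u : H|.
Proof. by rewrite norm_dot. Qed.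

Lemma orthogonal_normr_inner u : `|u| ^+ 2 = orthogonal_dot u u.
Proof. exact: dot_normK. Qed.

Lemma orthogonal_complete (F : set_system orthogonal) :
  ProperFilter F -> cauchy F -> cvg F.
Proof.
move=> FF /cauchy_ballP Fc.
have /cvg_ex[l Fl] : cvg ((fun v : orthogonal => v : H) @ F).
  apply/cauchy_cvgP/cauchy_ballP => e e0; rewrite near_map2.
  have := Fc e e0; rewrite !near_simpl; apply: filterS => -[u v] /=.
  by rewrite -!ball_normE /ball_ /= orthogonal_normE.
have lP : orthogonal_pred l.
  apply/asboolP => w Ew.
  have Fw : (fun v : orthogonal => inner (v : H) w) @ F --> inner l w.
    exact: cvg_innerl.
  apply: cvg_unique_norm Fw _.
  rewrite (_ : (fun _ => _) = cst 0); first exact: cvg_cst.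
  by apply/funext => v; have /asboolP/(_ _ Ew) := orthogonal_valP v.
apply/cvg_ex; exists (Orthogonal lP); apply/cvgrPdist_lt => e e0.
move/cvgrPdist_lt : Fl => /(_ _ e0); apply: filterS => v.
by rewrite orthogonal_normE.
Qed.

HB.instance Definition _ := Uniform_isComplete.Build orthogonal
  orthogonal_complete.

HB.instance Definition _ := isHilbert.Build R orthogonal
  orthogonal_normr_inner.

Lemma orthogonal_innerE u v : inner u v = inner (u : H) (v : H).
Proof. by []. Qed.

End orthogonal_complement.

Section rkhs_exists.
Variables (R : realType) (X : choiceType) (K : X -> X -> R[i]).
Variables (H : hilbertType R) (k : X -> H).
Hypothesis kK : forall x y, inner (k x) (k y) = K x y.

Let N := [set h | forall x, inner h (k x) = 0].
Let V := orthogonal N.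

Let k_subproof x : orthogonal_pred N (k x).
Proof. by apply/asboolP => w Nw; rewrite inner_conj Nw rmorph0. Qed.

Let kV x : V := Orthogonal (k_subproof x).

Let evV (f : V) : X -> R[i] := fun x => inner (f : H) (k x).

Let evV_linear : linear evV.
Proof. by move=> a f g; apply/funext => x; rewrite /evV innerDl innerZl. Qed.

HB.instance Definition _ := GRing.isLinear.Build R[i] V (X -> R[i]) _
  evV evV_linear.

Let evV_inj : injective evV.
Proof.
move=> f g fg; apply/eqP; rewrite -subr_eq0; apply/eqP/inner_eq0.
rewrite orthogonal_innerE.
have /asboolP := orthogonal_valP (f - g); apply => x.
have := congr1 (fun h => h x) fg; rewrite /evV innerBl => ->.
exact: subrr.
Qed.

(** The reproducing kernel space is the closed span of the feature vectors,
    realized as the complement of their annihilator [N], so that evaluation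
    against the feature vectors is injective on it. *)
Lemma rkhs_of_feature_map : rkhs K.
Proof.
apply: (@RKHS _ _ K V evV evV_inj kV) => // x.
by apply/funext => y; exact: kK.
Defined.

End rkhs_exists.

Lemma rkhs_exists (R : realType) (X : choiceType) (K : X -> X -> R[i]) :
  positive_definite K -> inhabited (rkhs K).
Proof.
by move=> /feature_map_exists[k kK]; exists; exact: rkhs_of_feature_map kK.
Qed.

(** * Square roots of positive contractions *)

Section bounded_operators.
Variables (R : realType) (H : hilbertType R).
Implicit Types (u v w : H) (Z Q : H -> H).

(** For an everywhere defined map this identity forces linearity
    ([symmetric_linear]); bounded self-adjoint operators are encoded as
    functions with this property. *)
Definition symmetric_map Z := forall u v, inner (Z u) v = inner u (Z v).
Definition nonexpansive Z := forall u, `|Z u| <= `|u|.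

Lemma inner_injl u v : (forall w, inner u w = inner v w) -> u = v.
Proof.
move=> uv; apply/eqP; rewrite -subr_eq0; apply/eqP/inner_eq0.
by rewrite innerBl uv subrr.
Qed.

Section symmetric.
Variable Z : H -> H.
Hypothesis Zs : symmetric_map Z.

Lemma symmetric_linear a u v : Z (a *: u + v) = a *: Z u + Z v.
Proof.
apply: inner_injl => w.
by rewrite Zs !innerDl !innerZl !Zs.
Qed.
Lemma symmetric0 : Z 0 = 0.
Proof. by apply: inner_injl => w; rewrite Zs !inner0l. Qed.
Lemma symmetricD u v : Z (u + v) = Z u + Z v.
Proof. by rewrite -{1}[u]scale1r symmetric_linear scale1r. Qed.
Lemma symmetricZ a u : Z (a *: u) = a *: Z u.
Proof. by rewrite -[_ *: u]addr0 symmetric_linear symmetric0 addr0. Qed.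
Lemma symmetricB u v : Z (u - v) = Z u - Z v.
Proof. by rewrite addrC -scaleN1r symmetric_linear scaleN1r addrC. Qed.

Lemma nonexpansive_cvg (f : nat -> H) l : nonexpansive Z ->
  f n @[n --> \oo] --> l -> Z (f n) @[n --> \oo] --> Z l.
Proof.
move=> Zc /cvgrPdist_lt fl; apply/cvgrPdist_lt => e /fl; apply: filterS => n.
by rewrite -symmetricB; exact: le_lt_trans.
Qed.
End symmetric.

Lemma norm_limit_le (f : nat -> H) l M : f n @[n --> \oo] --> l ->
  (forall n, `|f n| <= M) -> `|l| <= M.
Proof.
move=> /cvgrPdist_lt fl fM; apply/ler_addgt0Pr => e.
move=> /fl[N _ /(_ N (leqnn N)) lN].
rewrite -[l](subrK (f N)) (le_trans (ler_normD _ _))// addrC lerD//.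
exact: ltW.
Qed.

Lemma cvg_norm_le0 (f : nat -> H) (g : nat -> H) :
  (forall n, `|f n| <= `|g n|) -> g n @[n --> \oo] --> (0 : H) ->
  f n @[n --> \oo] --> (0 : H).
Proof.
move=> fg /cvgr0Pnorm_lt g0; apply/cvgr0Pnorm_lt => e /g0.
by apply: filterS => n; exact: le_lt_trans.
Qed.

Section square_root.
Variable Z : H -> H.
Hypotheses (Zs : symmetric_map Z) (Zc : nonexpansive Z).

Let W := fix W n : H -> H :=
  if n is m.+1 then fun u => 2^-1 *: (Z u + W m (W m u)) else fun=> 0.
Let w := fix w n : R := if n is m.+1 then 2^-1 * (1 + w m ^+ 2) else 0.

Let WS n u : W n.+1 u = 2^-1 *: (Z u + W n (W n u)). Proof. by []. Qed.
Let wS n : w n.+1 = 2^-1 * (1 + w n ^+ 2). Proof. by []. Qed.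

Let Ws n : symmetric_map (W n).
Proof.
elim: n => [|n IHn] u v; first by rewrite inner0l inner0r.
rewrite !WS innerZl innerZr innerDl innerDr Zs !IHn.
by rewrite fmorphV rmorph_nat.
Qed.

Let W_comm Q n : symmetric_map Q -> (forall u, Q (Z u) = Z (Q u)) ->
  forall u, Q (W n u) = W n (Q u).
Proof.
move=> Qs QZ; elim: n => [|n IHn] u; first by rewrite symmetric0.
by rewrite !WS symmetricZ// symmetricD// QZ !IHn.
Qed.

Let w_bounds n : [/\ 0 <= w n, w n <= w n.+1 & w n <= 1].
Proof.
elim: n => [|n [w0 wS1 w1]].
  by rewrite wS (_ : w 0 = 0)// expr0n /= addr0 mulr1; split; lra.
have w0' : 0 <= w n.+1 by exact: le_trans wS1.
have {}w1 : w n.+1 <= 1 by rewrite wS; nra.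
split=> //; rewrite [leLHS]wS [leRHS]wS ler_pM2l ?invr_gt0// lerD2l.
by rewrite ler_sqr ?nnegrE.
Qed.

Let W_norm n u : `|W n u| <= (w n)%:C%C * `|u|.
Proof.
elim: n u => [|n IHn] u; first by rewrite normr0 mul0r.
rewrite WS wS normrZ rmorphM /= normfV fmorphV rmorph_nat ger0_norm// -mulrA.
rewrite ler_wpM2l ?invr_ge0// (le_trans (ler_normD _ _))//.
rewrite rmorphD mulrDl rmorph1 mul1r lerD//.
rewrite (le_trans (IHn _))// rmorphXn /= expr2 -mulrA ler_wpM2l//.
by rewrite ler0c; case: (w_bounds n).
Qed.

Let WW m n u : W m (W n u) = W n (W m u).
Proof.
by apply: W_comm => // v; apply/esym/W_comm.
Qed.

Let W_diff n u : `|W n.+1 u - W n u| <= (w n.+1 - w n)%:C%C * `|u|.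
Proof.
elim: n u => [|n IHn] u.
  by rewrite subr0 subr0; exact: (W_norm 1).
have -> : W n.+2 u - W n.+1 u =
    2^-1 *: (W n.+1 (W n.+1 u - W n u) + W n (W n.+1 u - W n u)).
  rewrite (symmetricB (@Ws n.+1)) (symmetricB (@Ws n)).
  rewrite [W n (W n.+1 u)]WW addrA subrK.
  rewrite [W n.+2 u]WS [X in _ - X = _]WS -scalerBr.
  by rewrite opprD addrACA subrr add0r.
have -> : w n.+2 - w n.+1 = 2^-1 * ((w n.+1 + w n) * (w n.+1 - w n)).
  by rewrite [w n.+2]wS [X in _ - X = _]wS; ring.
rewrite normrZ rmorphM normfV fmorphV rmorph_nat ger0_norm// -mulrA.
rewrite ler_wpM2l ?invr_ge0// rmorphM -mulrA rmorphD mulrDl.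
have wc m : 0 <= (w m)%:C%C by rewrite ler0c; case: (w_bounds m).
rewrite (le_trans (ler_normD _ _))// lerD//.
  by rewrite (le_trans (W_norm _ _))// ler_wpM2l.
by rewrite (le_trans (W_norm _ _))// ler_wpM2l.
Qed.

Let W_dist m n u : (n <= m)%N -> `|W m u - W n u| <= (w m - w n)%:C%C * `|u|.
Proof.
move=> /subnK <-; elim: (m - n)%N => [|k IHk].
  by rewrite !subrr normr0 mul0r.
rewrite addSn -(subrKA (W (k + n) u)) (le_trans (ler_normD _ _))//.
by rewrite -(subrKA (w (k + n))) rmorphD mulrDl lerD// W_diff.
Qed.

Let W_cvg u : exists l : H, W n u @[n --> \oo] --> l.
Proof.
have w_nd : nondecreasing_seq w.
  by apply/nondecreasing_seqP => n; case: (w_bounds n).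
have : cvgn w.
  apply: nondecreasing_is_cvgn => //.
  by exists 1 => _ [n _ <-]; case: (w_bounds n).
move=> /cvg_ex[l /cvgrPdist_lt wl]; apply: cauchy_seq_cvg => e e0.
pose d := complex.Re (e / (1 + `|u|)).
have dE : d%:C%C = e / (1 + `|u|).
  by rewrite RRe_real// realM ?realV ?gtr0_real// ltr_pwDl.
have d0 : 0 < d by rewrite -ltcR dE divr_gt0// ltr_pwDl.
have [|N _ wN] := wl (d / 2); first by rewrite divr_gt0.
have bound m n : (N <= m)%N -> (N <= n)%N -> (n <= m)%N -> `|W m u - W n u| < e.
  move=> Nm Nn nm; rewrite (le_lt_trans (W_dist _ nm))//.
  apply: (@le_lt_trans _ _ (d%:C%C * `|u|)).
    rewrite ler_wpM2r// lecR.
    have := wN _ Nm; have := wN _ Nn; rewrite /= !ltr_norml.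
    by move=> /andP[? ?] /andP[? ?]; lra.
  by rewrite dE mulrAC ltr_pdivrMr ?ltr_pwDl// ltr_pM2l// ltrDr.
exists N => m n Nm Nn; have [nm|/ltnW mn] := leqP n m; first exact: bound.
by rewrite distrC bound.
Qed.

Let Wc n : nonexpansive (W n).
Proof.
move=> u; rewrite (le_trans (W_norm _ _))// -[leRHS]mul1r ler_wpM2r//.
by rewrite -(rmorph1 (real_complex R)) lecR; case: (w_bounds n).
Qed.

(** The fixed point [V = (Z + V^2) / 2] gives [(1 - V)^2 = 1 - Z]. The
    iterates of this equation from [0] differ by at most the differences of
    the scalar iterates of [w = (1 + w^2) / 2], which increase and are bounded
    by [1]; this holds because all iterates commute. *)
Lemma half_square_fixpoint : exists V : H -> H,
  [/\ symmetric_map V, nonexpansive V, forall u, Z u + V (V u) = 2 *: V u &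
    forall Q, symmetric_map Q -> nonexpansive Q ->
      (forall u, Q (Z u) = Z (Q u)) -> forall u, Q (V u) = V (Q u)].
Proof.
have /choice[V WV] := W_cvg.
have Vs : symmetric_map V.
  move=> u v; apply: cvg_unique_norm (cvg_innerl (v := v) (WV u)) _.
  by under eq_fun do rewrite Ws; exact: cvg_innerr.
exists V; split=> //.
- by move=> u; apply: norm_limit_le (WV u) _ => n; exact: Wc.
- move=> u; have WVS : W n.+1 u @[n --> \oo] --> V u.
    by rewrite (cvg_shiftS (fun n => W n u)).
  have WWV : W n (W n u) @[n --> \oo] --> V (V u).
    have -> : (fun n => W n (W n u)) = (fun n => W n (W n u - V u) + W n (V u)).
      by apply/funext => n; rewrite (symmetricB (@Ws n)) subrK.
    rewrite -[V (V u)]add0r; apply: cvgD => //.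
    apply: (@cvg_norm_le0 _ (fun n => W n u - V u)) => [n|].
      exact: Wc.
    by rewrite -(subrr (V u)); apply: cvgB => //; exact: cvg_cst.
  have : W n.+1 u @[n --> \oo] --> 2^-1 *: (Z u + V (V u)).
    under eq_fun do rewrite WS.
    by apply: cvgZr; apply: cvgD => //; exact: cvg_cst.
  move=> /(cvg_unique_norm WVS) Vu.
  by rewrite [in RHS]Vu scalerA divff ?pnatr_eq0// scale1r.
- move=> Q Qs Qc QZ u; apply: cvg_unique_norm (nonexpansive_cvg Qs Qc (WV u)) _.
  by under eq_fun do rewrite W_comm//; exact: WV.
Qed.
End square_root.

(** [C = 1 - V], where [V] solves the fixed point equation for [Z = 1 - A]. *)
Lemma positive_square_root (A : H -> H) : symmetric_map A -> nonexpansive A ->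
  nonexpansive (fun u => u - A u) ->
  exists C : H -> H, [/\ symmetric_map C, forall u, C (C u) = A u,
    nonexpansive (fun u => u - C u) &
    forall Q, symmetric_map Q -> nonexpansive Q ->
      (forall u, Q (A u) = A (Q u)) -> forall u, Q (C u) = C (Q u)].
Proof.
move=> As Ac A1c; have [|V [Vs Vc VE VQ]] := @half_square_fixpoint _ _ A1c.
  by move=> u v; rewrite innerBl innerBr As.
exists (fun u => u - V u); split.
- by move=> u v; rewrite innerBl innerBr Vs.
- move=> u; rewrite symmetricB// opprB.
  have -> : V (V u) = 2 *: V u - (u - A u) by rewrite -VE addrAC subrr add0r.
  by rewrite scaler_nat mulr2n [_ - _ - V u]addrAC addrK subrKA subKr.
- by move=> u; rewrite opprB addrC subrK.
- move=> Q Qs Qc QA u; rewrite symmetricB// VQ// => v.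
  by rewrite symmetricB// QA.
Qed.

End bounded_operators.

(** * Transport of sums and vectors along injections *)

Section transport.
Variables (R : realType) (Y X : choiceType) (i : Y -> X).
Hypothesis i_inj : injective i.
Implicit Types (f : X -> R[i]) (B : {fset X}) (D : {fset Y}).

Lemma fset_preimage B : exists D, forall y, (y \in D) = (i y \in B).
Proof.
have /choice[j jP] x : exists o : option Y,
    forall y, (o == Some y) = (i y == x).
  have [[y <-]|xi] := pselect (exists y, i y = x).
    by exists (Some y) => z; rewrite (inj_eq i_inj) eq_sym.
  by exists None => y; apply/esym/eqP => yx; apply: xi; exists y.
exists [fset y in pmap j B]%fset => y; rewrite !inE /=.
apply/idP/idP; rewrite mem_pmap.
  by move=> /mapP[x xB /esym/eqP]; rewrite jP => /eqP ->.
move=> yB; apply/mapP; exists (i y) => //.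
by apply/esym/eqP; rewrite jP.
Qed.

Lemma sum_image f D B : (forall x, f x != 0 -> exists y, i y = x) ->
  (forall y, i y \in B -> f (i y) != 0 -> y \in D) ->
  (forall y, y \in D -> f (i y) != 0 -> i y \in B) ->
  \sum_(x <- B) f x = \sum_(y <- D) f (i y).
Proof.
move=> fi BD DB.
have <- : \sum_(x <- (i @` D)%fset) f x = \sum_(y <- D) f (i y).
  by rewrite big_imfset//= => y z _ _; exact: i_inj.
rewrite (big_fset_incl _ (fsubsetUl B (i @` D)%fset)); last first.
  move=> x; rewrite inE => /orP[->//|/imfsetP[/= y yD ->] yB].
  by apply/eqP; apply: contraNT yB; exact: DB.
apply: esym; rewrite (big_fset_incl _ (fsubsetUr B (i @` D)%fset))//.
move=> x; rewrite inE => /orP[xB xD|->//].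
apply/eqP; apply: contraNT xD => fx; have [y yx] := fi x fx.
by rewrite -yx; apply/imfsetP; exists y => //; apply: BD; rewrite yx.
Qed.

Lemma has_sum_image f s : (forall x, f x != 0 -> exists y, i y = x) ->
  has_sum f s <-> has_sum (f \o i) s.
Proof.
move=> fi; split=> /has_sumP fs; apply/has_sumP => e /fs[A As].
  have [D DA] := fset_preimage A; exists D => B DB.
  rewrite -(@sum_image f B (A `|` (i @` B))%fset)//.
  - by apply: As; exact: fsubsetUl.
  - move=> y; rewrite inE => /orP[yA|/imfsetP[/= z zB /i_inj ->]//] _.
    by apply: (fsubsetP DB); rewrite DA.
  - by move=> y yB _; rewrite inE in_imfset ?orbT.
exists (i @` A)%fset => B AB; have [D DB] := fset_preimage B.
rewrite (@sum_image f D)//; [|by move=> y; rewrite DB..].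
apply: As; apply/fsubsetP => y yA; rewrite DB; apply: (fsubsetP AB).
exact: in_imfset.
Qed.

Definition zero_extension (f : Y -> R[i]) : X -> R[i] := fun x =>
  if pselect (exists y, i y = x) is left p then f (sval (cid p)) else 0.

Lemma zero_extensionE (f : Y -> R[i]) y : zero_extension f (i y) = f y.
Proof.
rewrite /zero_extension; case: pselect => [p|[]]; last by exists y.
by case: cid => z /= /i_inj ->.
Qed.

Lemma zero_extension_supp (f : Y -> R[i]) x :
  zero_extension f x != 0 -> exists y, i y = x.
Proof. by rewrite /zero_extension; case: pselect; rewrite ?eqxx. Qed.

Lemma l2_push_subproof (f : l2 R Y) : square_summable_pred (zero_extension f).
Proof.
apply/asboolP/square_summableP.
have /square_summableP[M fM] := l2_square_summable f.
exists M => B; have [D DB] := fset_preimage B.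
rewrite (@sum_image _ D)//.
- by under eq_bigr do rewrite zero_extensionE; exact: fM.
- move=> x x0; apply: (@zero_extension_supp f).
  by apply: contraNneq x0 => ->; rewrite normr0 expr0n.
- by move=> y; rewrite DB.
- by move=> y; rewrite DB.
Qed.

Definition l2_push (f : l2 R Y) : l2 R X := L2 (l2_push_subproof f).

Lemma l2_pull_subproof (f : l2 R X) : square_summable_pred (fun y => f (i y)).
Proof.
apply/asboolP/square_summableP.
have /square_summableP[M fM] := l2_square_summable f.
exists M => D; rewrite (le_trans _ (fM (i @` D)%fset))// big_imfset//=.
by move=> y z _ _; exact: i_inj.
Qed.

Definition l2_pull (f : l2 R X) : l2 R Y := L2 (l2_pull_subproof f).

(** Extension by zero is an isometry whose adjoint is restriction. *)
Lemma inner_push (f : l2 R Y) (g : l2 R X) :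
  inner (l2_push f) g = inner f (l2_pull g).
Proof.
rewrite [LHS]l2_innerE; apply: sum_has_sum; apply/has_sum_image => [x x0|].
  apply: (@zero_extension_supp f); apply: contraNneq x0 => /= ->.
  by rewrite mul0r.
rewrite (_ : _ \o _ = fun y => f y * (l2_pull g y)^*).
  exact: l2_has_sum.
by apply/funext => y /=; rewrite zero_extensionE.
Qed.

Lemma inner_pull (f : l2 R X) (g : l2 R Y) :
  inner (l2_pull f) g = inner f (l2_push g).
Proof. by rewrite inner_conj -inner_push [RHS]inner_conj. Qed.

Lemma l2_pushK (f : l2 R Y) : l2_pull (l2_push f) = f.
Proof. by apply: l2P => y; exact: zero_extensionE. Qed.

Lemma norm_push (f : l2 R Y) : `|l2_push f| = `|f|.
Proof.
by apply/eqP; rewrite -(@eqrXn2 _ 2)// !normr_inner inner_push l2_pushK.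
Qed.

Lemma norm_pull (f : l2 R X) : `|l2_pull f| <= `|f|.
Proof.
have [->|f0] := eqVneq `|l2_pull f| 0; first exact: normr_ge0.
have pf0 : 0 < `|l2_pull f| by rewrite lt_neqAle eq_sym f0 normr_ge0.
rewrite -(ler_pM2r pf0) -expr2 -{2}(norm_push (l2_pull f)).
apply: le_trans (inner_CauchySchwarz f _).
by rewrite -inner_pull ger0_norm ?inner_ge0// normr_inner.
Qed.

Lemma l2_pullB (f g : l2 R X) : l2_pull (f - g) = l2_pull f - l2_pull g.
Proof. by apply: l2P. Qed.

End transport.

(** * Quotients of commuting contractions *)

Lemma pair_closureP (R : realType) (V W : normedModType R[i])
    (G : set (V * W)) p :
  closure G p <-> forall e : R[i], 0 < e ->
    exists2 q, G q & `|p.1 - q.1| < e /\ `|p.2 - q.2| < e.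
Proof.
split=> [Gp e e0|Gp B /nbhs_ballP[e /= e0 eB]].
  have [q [Gq pq]] := Gp _ (nbhsx_ballx p e e0); exists q => //.
  by case: pq; rewrite -!ball_normE.
have [q Gq [pq1 pq2]] := Gp _ e0; exists q; split=> //.
by apply: eB; split; rewrite -ball_normE.
Qed.

Lemma dense_approx (R : realType) (V : normedModType R[i]) (D : set V) :
  (forall v (e : R[i]), 0 < e -> exists2 u, D u & `|v - u| < e) -> dense D.
Proof.
move=> Dv O [v Ov] Oo.
have /nbhs_ballP[e /= e0 eO] := open_nbhs_nbhs (conj Oo Ov).
have [u Du vu] := Dv v e e0; exists u; split=> //.
by apply: eO; rewrite -ball_normE.
Qed.

Lemma norm_le_eps_eq0 (R : realType) (V : normedModType R[i]) (v : V) :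
  (forall e : R[i], 0 < e -> `|v| <= e) -> v = 0.
Proof.
move=> ve; apply/eqP; rewrite -normr_le0; apply/ler_addgt0Pr => e e0.
by rewrite add0r ve.
Qed.

(** Closability of [e_x |-> k_x] on finitely supported vectors, stated for the
    family itself because it depends on its Gram matrix only
    ([closable_family_transfer]). *)
Definition closable_family (R : realType) (X : choiceType) (H : hilbertType R)
    (k : X -> H) :=
  forall h, (forall e : R[i], 0 < e -> exists u,
    [/\ lfin u, `|u| < e & `|h - lfin_operator k u| < e]) -> h = 0.

Section operator_on.
Variables (R : realType) (H : hilbertType R).

Lemma norm_le_inner (u v : H) : inner u u = inner u v -> `|u| <= `|v|.
Proof.
move=> uv; have [->|u0] := eqVneq `|u| 0; first exact: normr_ge0.
have {}u0 : 0 < `|u| by rewrite lt_neqAle eq_sym u0 normr_ge0.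
rewrite -(ler_pM2l u0) -expr2; apply: le_trans (inner_CauchySchwarz u v).
by rewrite -uv ger0_norm ?inner_ge0// normr_inner.
Qed.

Lemma nonexpansive_positive (S : H -> H) : symmetric_map S ->
  nonexpansive (fun u => u - S u) -> forall u, 0 <= inner (S u) u.
Proof.
move=> Ss Sc u; have -> : inner (S u) u = inner u u - inner (u - S u) u.
  by rewrite innerBl subKr.
rewrite subr_ge0 (le_trans (real_ler_norm _))//.
  by apply/CrealP; rewrite -inner_conj innerBl innerBr Ss.
by rewrite (le_trans (inner_CauchySchwarz _ _))// -normr_inner expr2 ler_wpM2r.
Qed.

Lemma nonexpansive_of_square (A C : H -> H) :
  symmetric_map C -> nonexpansive A ->
  (forall u, C (C u) = A u) -> nonexpansive C.
Proof.
move=> Cs Ac CA u; rewrite -ler_sqr ?nnegrE// normr_inner.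
rewrite -(ger0_norm (inner_ge0 _)) Cs CA (le_trans (inner_CauchySchwarz _ _))//.
by rewrite expr2 ler_wpM2l.
Qed.

Section polar.
Variables (C S : H -> H).
Hypotheses (Cs : symmetric_map C) (Ss : symmetric_map S).
Hypotheses (Cc : nonexpansive C) (Sc : nonexpansive S).
Hypothesis CS : forall u, C (S u) = S (C u).
Hypothesis CCSS : forall u, C (C u) + S (S u) = u.
Hypothesis C_inj : forall u, C u = 0 -> u = 0.

Let C_injective : injective C.
Proof.
move=> u v uv; apply/eqP; rewrite -subr_eq0; apply/eqP/C_inj.
by rewrite symmetricB// uv subrr.
Qed.

Let Cinv f := xget 0 [set h | C h = f].

Let CK h : Cinv (C h) = h.
Proof.
apply: C_injective; rewrite /Cinv.
exact: (@xgetPex _ 0 [set h' | C h' = C h] (ex_intro _ h erefl)).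
Qed.

Let B_dom0 : range C 0.
Proof. by exists 0 => //; exact: symmetric0. Qed.

Let B_dom_linear (a : R[i]) u v :
  range C u -> range C v -> range C (a *: u + v).
Proof.
move=> [f _ <-] [g _ <-]; exists (a *: f + g) => //.
by rewrite symmetric_linear.
Qed.

Let B_linear (a : R[i]) u v : range C u -> range C v ->
  S (Cinv (a *: u + v)) = a *: S (Cinv u) + S (Cinv v).
Proof.
move=> [f _ <-] [g _ <-]; rewrite -(symmetric_linear Cs) !CK.
exact: symmetric_linear.
Qed.

(** The operator [S C^-1]; its graph is the image of the isometry sending [h]
    to [(C h, S h)]. *)
Definition quotient_operator : operator H H :=
  Operator B_dom0 B_dom_linear B_linear.
Local Notation B := quotient_operator.

Lemma quotient_operatorE h : B (C h) = S h.
Proof. by rewrite /= CK. Qed.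

(** If [S f = C g] then [h = C f + S g] satisfies [C h = f] and [S h = g]. *)
Lemma graph_quotient : graph B = [set p | S p.1 = C p.2].
Proof.
apply/seteqP; split=> [[f g] [/= [h _ <-] <-]|[f g] /= fg].
  by rewrite CK CS.
have fE : C (C f + S g) = f.
  by rewrite symmetricD// CS -fg CCSS.
split; first by exists (C f + S g).
rewrite /= -[in LHS]fE CK symmetricD// -CS fg.
exact: CCSS.
Qed.

Lemma quotient_positive : nonexpansive (fun u => u - C u) ->
  nonexpansive (fun u => u - S u) -> positive_operator B.
Proof.
move=> C1 S1 _ [h _ <-]; rewrite quotient_operatorE.
(* With [C = D^2], [<S h, C h> = <S D h, D h>]. *)
have [D [Ds DD _ D_comm]] := positive_square_root Cs Cc C1.
have DS u : S (D u) = D (S u) by apply: D_comm => // v; rewrite CS.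
by rewrite -DD -Ds -DS; exact: nonexpansive_positive.
Qed.

(** The adjoint graph is cut out by [<S h, f> = <C h, g>] for all [h], which
    is again the equation [S f = C g]. *)
Lemma quotient_self_adjoint : dense (range C) -> self_adjoint B.
Proof.
move=> Cd; split=> //; rewrite graph_quotient; apply/seteqP.
split=> -[f g] /= fg; last first.
  apply: inner_injl => w; rewrite inner_conj [RHS]inner_conj; congr (_^*).
  by rewrite -Ss -Cs -quotient_operatorE; apply: fg; exists w.
by move=> _ [h _ <-]; rewrite quotient_operatorE Ss Cs fg.
Qed.

Lemma quotient_closed : closed (graph B).
Proof.
apply/closure_id; apply/seteqP; split; first exact: subset_closure.
move=> p /pair_closureP pB; rewrite graph_quotient /=.
apply/eqP; rewrite -subr_eq0; apply/eqP/norm_le_eps_eq0 => e e0.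
have [|q] := pB (e / 2); first by rewrite divr_gt0.
rewrite graph_quotient /= => Sq [pq1 pq2].
rewrite -(subrKA (S q.1)) (le_trans (ler_normD _ _))// (splitr e) lerD//.
  by rewrite -(symmetricB Ss) (le_trans (Sc _))// ltW.
by rewrite Sq -(symmetricB Cs) (le_trans (Cc _))// distrC ltW.
Qed.

Lemma quotient_core (D : set H) :
  (forall h (e : R[i]), 0 < e -> exists2 u, D (C u) & `|h - u| < e) ->
  closure (graph_on D B) = graph B.
Proof.
move=> DC; apply/seteqP; split=> [p|].
  rewrite [X in _ -> X p](closure_id _).1; last exact: quotient_closed.
  by apply: closureS => ? [].
move=> [f g] [/= [h _ <-]]; rewrite CK => <-.
apply/pair_closureP => e e0; have [u Du hu] := DC h e e0; exists (C u, S u).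
  by split=> //; split; [exists u|exact: quotient_operatorE].
rewrite /= -(symmetricB Cs) -(symmetricB Ss).
by split; [exact: le_lt_trans (Cc _) _|exact: le_lt_trans (Sc _) _].
Qed.

End polar.
End operator_on.

(** * The modulus of a closable factorization *)

Section closable_to_positive.
Variables (R : realType) (X : choiceType) (k : X -> l2 R X).
Hypothesis k_closable : closable_family k.
Local Notation Y := (X + X)%type.
Local Notation e_ := (@l2_basis R X).

Let inl_inj : injective (@inl X X). Proof. by move=> x y []. Qed.
Let inr_inj : injective (@inr X X). Proof. by move=> x y []. Qed.

Let pushl := l2_push inl_inj (R := R).
Let pushr := l2_push inr_inj (R := R).
Let pulll := l2_pull inl_inj (R := R).
Let pullr := l2_pull inr_inj (R := R).

(** The points [(e_x, k_x)] of the graph, in the direct sum of two copies of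
    the space. *)
Let g x : l2 R Y := pushl (e_ x) + pushr (k x).

Let T := lfin_operator g.

Let pull_lr (w : l2 R Y) : pulll w = 0 -> pullr w = 0 -> w = 0.
Proof.
move=> w1 w2; apply: l2P => -[x|x].
  by have := congr1 (fun v : l2 R X => v x) w1.
by have := congr1 (fun v : l2 R X => v x) w2.
Qed.

Let pulll_pushr u : pulll (pushr u) = 0.
Proof.
apply: l2P => x; apply/eqP; apply: contrapT.
by move=> /negP /(@zero_extension_supp _ _ _ inr)[].
Qed.

Let pullr_pushl u : pullr (pushl u) = 0.
Proof.
apply: l2P => x; apply/eqP; apply: contrapT.
by move=> /negP /(@zero_extension_supp _ _ _ inl)[].
Qed.

Let inner_pushl w u : inner w (pushl u) = inner (pulll w) u.
Proof. exact/esym/inner_pull. Qed.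
Let inner_pushr w u : inner w (pushr u) = inner (pullr w) u.
Proof. exact/esym/inner_pull. Qed.
Let pushlK u : pulll (pushl u) = u. Proof. exact: l2_pushK. Qed.
Let pushrK u : pullr (pushr u) = u. Proof. exact: l2_pushK. Qed.
Let pulll_le w : `|pulll w| <= `|w|. Proof. exact: norm_pull. Qed.
Let pullr_le w : `|pullr w| <= `|w|. Proof. exact: norm_pull. Qed.
Let norm_pushl u : `|pushl u| = `|u|. Proof. exact: norm_push. Qed.
Let pulllB w w' : pulll (w - w') = pulll w - pulll w'.
Proof. exact: l2_pullB. Qed.
Let pullrB w w' : pullr (w - w') = pullr w - pullr w'.
Proof. exact: l2_pullB. Qed.

Let inner_g_pushl x u : inner (g x) (pushl u) = inner (e_ x) u.
Proof.
by rewrite innerDl !inner_pushl pushlK pulll_pushr inner0l addr0.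
Qed.

Let inner_g_pushr x u : inner (g x) (pushr u) = inner (k x) u.
Proof.
by rewrite innerDl !inner_pushr pullr_pushl pushrK inner0l add0r.
Qed.

Let inner_gg x y : inner (g x) (g y) = inner (e_ x) (e_ y) + inner (k x) (k y).
Proof. by rewrite [X in inner _ X]/g innerDr inner_g_pushl inner_g_pushr. Qed.

Let pulll_T u : lfin u -> pulll (T u) = u.
Proof.
move=> uf; apply: inner_injl => v; rewrite -inner_pushl.
by rewrite (lfin_gram (k' := e_) (z' := v)) ?lfin_operator_id.
Qed.

Let pullr_T u : lfin u -> pullr (T u) = lfin_operator k u.
Proof.
move=> uf; apply: inner_injl => v; rewrite -inner_pushr.
exact: lfin_gram.
Qed.

Let G := closure (op_range T).

(** This is closability read on the closed graph, which contains no vector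
    [(0, h)] with [h] nonzero. *)
Let pulll_inj w : G w -> pulll w = 0 -> w = 0.
Proof.
move=> Gw w1; apply: pull_lr => //; apply: k_closable => e e0.
have [u uf wu] := (closure_imageP _ _ _).1 Gw e e0.
exists u; split=> //.
  rewrite -normrN -[- u]add0r -[in ltLHS]w1 -(pulll_T uf) -pulllB.
  exact: le_lt_trans (pulll_le _) _.
by rewrite -(pullr_T uf) -pullrB; exact: le_lt_trans (pullr_le _) _.
Qed.

(** The modulus of the closure of [e_x |-> k_x]: in the notation of the
    introduction, the proof writes [b] for [J^*]. *)
Lemma closable_family_positive : exists B : operator (l2 R X) (l2 R X),
  [/\ positive_operator B, self_adjoint B,
    lfin `<=` op_dom B /\
    (forall x y, inner (k x) (k y) = inner (B (e_ x)) (B (e_ y))) &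
    is_core lfin B].
Proof.
have /choice[P PP] w : exists m, G m /\
    forall u, lfin u -> inner (T u) w = inner (T u) m.
  by have [m Gm mw] := projection T w; exists m.
have GP w : G (P w) by case: (PP w).
have innerP m w : G m -> inner m w = inner m (P w).
  by move=> Gm; apply: (closure_range_inner Gm); case: (PP w).
have Gg x : G (g x).
  rewrite -(lfin_operator_basis g); exact/closure_range_fun/lfin_basis.
have GB m m' : G m -> G m' -> G (m - m').
  by move=> Gm Gm'; rewrite addrC -scaleN1r; exact: closure_range_linear.
have G_eq0 m : G m -> (forall x, inner (g x) m = 0) -> m = 0.
  move=> Gm gm; apply: (closure_range_eq Gm).
    by rewrite -(op_fun0 T); apply/closure_range_fun/op_dom0.
  by move=> u uf; apply: lfin_gram => // x; rewrite gm inner0r.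
pose A u := pulll (P (pushl u)).
have AE u v : inner (A u) v = inner (P (pushl u)) (P (pushl v)).
  exact: etrans (esym (inner_pushl _ _)) (innerP _ _ (GP _)).
have As : symmetric_map A.
  by move=> u v; rewrite AE inner_conj -AE -inner_conj.
have P_le w : `|P w| <= `|w|.
  by apply: norm_le_inner; rewrite [RHS](innerP _ _ (GP _)).
have P1_le w : `|w - P w| <= `|w|.
  apply: norm_le_inner; rewrite innerBr.
  rewrite [X in _ - X](_ : _ = 0) ?subr0// inner_conj innerBr.
  by rewrite -(innerP _ _ (GP _)) subrr rmorph0.
have Ac : nonexpansive A.
  move=> u; apply: le_trans (pulll_le _) _.
  by rewrite (le_trans (P_le _))// norm_pushl.
have A1c : nonexpansive (fun u => u - A u).
  move=> u; rewrite -{1}(pushlK u) -pulllB.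
  apply: le_trans (pulll_le _) _.
  by rewrite (le_trans (P1_le _))// norm_pushl.
have [C [Cs CC C1 C_comm]] := positive_square_root As Ac A1c.
have Cc := nonexpansive_of_square Cs Ac CC.
have A1s : symmetric_map (fun u => u - A u).
  by move=> u v; rewrite innerBl innerBr As.
have A11c : nonexpansive (fun u => u - (u - A u)).
  by move=> u; rewrite subKr.
have [S [Ss SS S1 S_comm]] := positive_square_root A1s A1c A11c.
have Sc := nonexpansive_of_square Ss A1c SS.
have CS u : C (S u) = S (C u).
  by apply: S_comm => // v; rewrite symmetricB// -!CC.
have CCSS u : C (C u) + S (S u) = u by rewrite CC SS addrC subrK.
have A_inj u : A u = 0 -> u = 0.
  move=> Au; have Pu : P (pushl u) = 0.
    by apply: inner_eq0; rewrite -AE Au inner0l.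
  apply: l2P => x; rewrite -inner_basisr inner_conj -inner_g_pushl innerP//.
  by rewrite Pu inner0r rmorph0.
have C_inj u : C u = 0 -> u = 0.
  by move=> Cu; apply: A_inj; rewrite -CC Cu symmetric0.
pose b u := P (pushl u).
have b_lin a u v : b (a *: u + v) = a *: b u + b v.
  apply: (closure_range_eq (GP _)).
    exact: (closure_range_linear (GP _) (GP _)).
  move=> w wf; rewrite -(PP _).2// innerDr innerZr -!(PP _).2//.
  by rewrite !inner_pushl innerDr innerZr.
pose Ta := total_operator (symmetric_linear Cs).
pose Tb := total_operator b_lin.
have gram u v : inner (Tb u) (Tb v) = inner (Ta u) (Ta v).
  by rewrite /= -AE Cs CC As.
have range_b m : closure (op_range Tb) m -> G m.
  have GE : closure G = G by apply/esym/(closure_id _).1; exact: closed_closure.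
  by rewrite -GE; apply: closureS => _ [u _ <-]; exact: GP.
(* The adjoint of an injective map has dense range. *)
have g_range_b x : closure (op_range Tb) (g x).
  have [m mb mg] := projection Tb (g x).
  suff -> : g x = m by [].
  apply/eqP; rewrite -subr_eq0; apply/eqP/pulll_inj.
    exact/GB/range_b.
  apply: inner_injl => v; rewrite inner0l -inner_pushl innerP.
    2: exact/GB/range_b.
  by rewrite inner_conj innerBr [X in X - _](mg v)// subrr rmorph0.
have /choice[h hP] x : exists h, closure (op_range Ta) h /\
    forall z z', (forall u, inner (Tb u) z = inner (Ta u) z') ->
    inner (g x) z = inner h z'.
  have [//|u v _ _||h hT hg] := @gram_limit _ _ _ _ Tb Ta (g x).
    exact: gram.
    exact: g_range_b.
  by exists h; split=> // z z' zz'; apply: hg.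
have ghb x v : inner (g x) (b v) = inner (h x) (C v).
  by apply: (hP x).2 => u; exact: gram.
have Ch x : C (h x) = e_ x.
  apply: inner_injl => v; rewrite Cs -ghb -inner_g_pushl.
  exact/esym/innerP.
have gh x u : inner (Tb u) (g x) = inner (Ta u) (h x).
  by rewrite /= inner_conj ghb -inner_conj.
have hh x y : inner (h x) (h y) = inner (g x) (g y).
  by apply/esym/(hP x).2 => u; exact: gh.
(* A vector orthogonal to all [h_x] corresponds to a vector of [G] orthogonal
   to all [g_x]. *)
have h_total w (e : R[i]) : 0 < e ->
    exists2 u, lfin u & `|w - lfin_operator h u| < e.
  move=> e0; suff /closure_imageP : closure (op_range (lfin_operator h)) w.
    exact.
  apply: total_closure_range => {}w hw.
  have wa : closure (op_range Ta) w.
    apply: total_closure_range => u Cu; apply: C_inj.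
    by apply: inner_injl => v; rewrite inner0l Cs inner_conj (Cu v)// rmorph0.
  have [//|u v _ _|//|m mb mw] := @gram_limit _ _ _ _ Ta Tb w.
    exact/esym/gram.
  have m0 : m = 0.
    apply: G_eq0 => [|x]; first exact: range_b.
    rewrite inner_conj -(mw (h x)); last by move=> u _; rewrite gh.
    rewrite inner_conj -{1}(lfin_operator_basis h x) hw ?rmorph0//.
    exact: lfin_basis.
  apply: inner_eq0; rewrite (mw w m); first by rewrite m0 inner0l.
  move=> u _; rewrite inner_conj [RHS]inner_conj (mw (Ta u) (Tb u))//.
have ChT u : lfin u -> C (lfin_operator h u) = u.
  move=> uf; apply: inner_injl => v; rewrite Cs.
  rewrite (lfin_gram (k' := e_) (z' := v)) ?lfin_operator_id// => x.
  by rewrite -Cs Ch.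
have C_lfin : lfin `<=` range C.
  by move=> u uf; exists (lfin_operator h u) => //; exact: ChT.
exists (quotient_operator Cs Ss C_inj); split.
- exact: quotient_positive.
- apply: quotient_self_adjoint => //; apply: dense_approx => v e e0.
  by have [u /C_lfin] := lfin_approx v e0; exists u.
- split=> // x y.
  rewrite -!Ch !quotient_operatorE Ss.
  have -> : S (S (h y)) = h y - C (C (h y)).
    by rewrite -{2}(CCSS (h y)) addrC addKr.
  by rewrite innerBr hh inner_gg -Cs !Ch addrC addKr.
- split; [exact: quotient_closed|exact: C_lfin|].
  apply: quotient_core => // w e e0; have [u uf wu] := h_total w e e0.
  by exists (lfin_operator h u) => //; rewrite ChT.
Qed.
End closable_to_positive.

(** * Closable operators and closable families *)

Section closability.
Variables (R : realType).

Lemma closure_graph_linear (U V : hilbertType R) (T : operator U V)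
    (a : R[i]) p q : closure (graph T) p -> closure (graph T) q ->
  closure (graph T) (a *: p.1 + q.1, a *: p.2 + q.2).
Proof.
move=> /pair_closureP Tp /pair_closureP Tq; apply/pair_closureP => e e0.
have a1 : 0 < 1 + `|a| by rewrite ltr_pwDl.
have d0 : 0 < e / 2 / (1 + `|a|) by rewrite !divr_gt0.
have [[u _] [/= Tu <-] [pu1 pu2]] := Tp _ d0.
have e2 : 0 < e / 2 by rewrite divr_gt0.
have [[v _] [/= Tv <-] [qv1 qv2]] := Tq _ e2.
have key (W : hilbertType R) (x y x' y' : W) : `|x - y| < e / 2 / (1 + `|a|) ->
    `|x' - y'| < e / 2 -> `|a *: x + x' - (a *: y + y')| < e.
  move=> xy xy'; rewrite opprD addrACA -scalerBr (splitr e).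
  rewrite (le_lt_trans (ler_normD _ _))// ler_ltD// normrZ.
  move: xy; rewrite ltr_pdivlMr// => /ltW; apply: le_trans.
  by rewrite mulrDr mulr1 mulrC lerDr.
exists (a *: u + v, a *: T u + T v); last by split; apply: key.
by split; [exact: op_dom_linear|exact: op_fun_linear].
Qed.

(** The closure of the graph is a linear relation, single-valued as soon as it
    is so above [0]. *)
Lemma closable_of_zero_limit (U V : hilbertType R) (T : operator U V) :
  (forall h, closure (graph T) (0, h) -> h = 0) -> closable T.
Proof.
move=> T0; pose G := closure (graph T).
have G00 : G (0, 0).
  by apply: subset_closure; split; [exact: op_dom0|exact: op_fun0].
have G_uniq u h h' : G (u, h) -> G (u, h') -> h = h'.
  move=> uh uh'; apply/eqP; rewrite -subr_eq0; apply/eqP/T0.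
  have := closure_graph_linear (a := - 1) uh' uh.
  by rewrite /= scaleN1r addNr scaleN1r addrC.
pose D u := exists h, G (u, h).
pose S u := xget 0 [set h | G (u, h)].
have GS u : D u -> G (u, S u).
  by move=> Du; exact: (@xgetPex _ 0 [set h | G (u, h)] Du).
have SE u h : G (u, h) -> S u = h.
  by move=> uh; apply: (@G_uniq u) => //; apply: GS; exists h.
have D0 : D 0 by exists 0.
have Dl (a : R[i]) u v : D u -> D v -> D (a *: u + v).
  move=> [h uh] [h' vh']; exists (a *: h + h').
  exact: (closure_graph_linear uh vh').
have Sl (a : R[i]) u v : D u -> D v -> S (a *: u + v) = a *: S u + S v.
  move=> Du Dv; apply: SE.
  exact: (closure_graph_linear (GS _ Du) (GS _ Dv)).
exists (Operator D0 Dl Sl); apply/seteqP; split=> [[u h] uh|[u h] [/= Du <-]].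
  by split; [exists h|exact: SE].
exact: GS.
Qed.

Variable X : choiceType.
Local Notation e_ := (@l2_basis R X).

Lemma closable_family_operator (H : hilbertType R) (k : X -> H) :
  closable_family k -> closable (lfin_operator k).
Proof.
move=> kc; apply: closable_of_zero_limit => h /pair_closureP h0.
apply: kc => e e0.
have [[u _] [/= uf <-] [u0 hu]] := h0 e e0; exists u; split=> //.
by move: u0; rewrite sub0r normrN.
Qed.

Lemma closable_operator_family (H : hilbertType R) (T : operator (l2 R X) H) :
  lfin `<=` op_dom T -> closable T -> closable_family (fun x => T (e_ x)).
Proof.
move=> TD [S TS] h h0; have : graph S (0, h).
  rewrite -TS; apply/pair_closureP => e e0; have [u [uf u0 hu]] := h0 e e0.
  exists (u, T u); first by split => //; exact: TD.
  by rewrite /= sub0r normrN lfin_operatorE.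
by move=> [_] /= <-; exact: op_fun0.
Qed.

(** A null sequence whose images converge for one family has Cauchy images for
    the other; these tend to [0], and the norms agree. *)
Lemma closable_family_transfer (H H' : hilbertType R)
    (k : X -> H) (k' : X -> H') :
  (forall x y, inner (k x) (k y) = inner (k' x) (k' y)) ->
  closable_family k -> closable_family k'.
Proof.
move=> kk' kc h' h'0.
have /choice[u uP] n : exists u, [/\ lfin u, `|u| < n.+1%:R^-1 &
    `|h' - lfin_operator k' u| < n.+1%:R^-1].
  by apply: h'0; rewrite invr_gt0.
have uf n : lfin (u n) by case: (uP n).
have T'u : lfin_operator k' (u n) @[n --> \oo] --> h'.
  apply/cvgrPdist_lt => e /near_invSn_lt; apply: filterS => n.
  by apply: lt_trans; case: (uP n).
have T_norm v : lfin v -> `|lfin_operator k v| = `|lfin_operator k' v|.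
  move=> vf; apply/eqP; rewrite -(@eqrXn2 _ 2)// !normr_inner.
  by rewrite (lfin_gram2 kk').
have [|h Tu] := @cauchy_seq_cvg _ _ (fun n => lfin_operator k (u n)).
  move=> e e0; have [N uN] := cvg_cauchy_seq T'u e0.
  exists N => i j Ni Nj.
  have : `|lfin_operator k' (u i) - lfin_operator k' (u j)| < e by exact: uN.
  rewrite -(op_funB (T := lfin_operator k') (uf i) (uf j)) -T_norm; last first.
    exact: (op_domB (T := lfin_operator k) (uf i) (uf j)).
  by rewrite (op_funB (T := lfin_operator k) (uf i) (uf j)).
have h0 : h = 0.
  apply: kc => e e0; move/cvgrPdist_lt : Tu => /(_ _ e0) Tu.
  have [N _ /(_ N (leqnn N)) [Nu Ne]] := filterI Tu (near_invSn_lt e0).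
  by exists (u N); split=> //; apply: lt_trans Ne; case: (uP N).
apply/eqP; rewrite -normr_eq0; apply/eqP.
apply: cvg_unique_norm (cvg_norm T'u) _.
under eq_fun do rewrite -T_norm//.
by rewrite -(normr0 H) -h0; exact: cvg_norm.
Qed.

End closability.

(** * Roots and square-summable factors *)

Section square_summable_sums.
Variables (R : realType) (X : choiceType).

Lemma has_sum_square_summable (f : X -> R[i]) s :
  has_sum (fun x => f x * (f x)^*) s -> square_summable f.
Proof.
move=> /has_sumP/(_ 1 ltr01)[A As]; apply/square_summableP.
pose M := `|s| + 1; exists (complex.Re M) => B.
rewrite RRe_real; last by rewrite ger0_real// addr_ge0.
apply: (@le_trans _ _ (\sum_(x <- (A `|` B)%fset) `|f x| ^+ 2)).
  have := ler_sum_fset (h := fun x => complex.Re `|f x| ^+ 2)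
    (fun x => sqr_ge0 _) (fsubsetUr A B).
  rewrite -lecR !rmorph_sum; congr (_ <= _); apply: eq_bigr => x _;
  by rewrite rmorphXn /= Re_normE.
have := As _ (fsubsetUl A B); under eq_bigr do rewrite -normCK.
set S := (X in `|s - X|); move=> sS.
have S0 : 0 <= S by apply: sumr_ge0 => x _; rewrite exprn_ge0.
suff : S <= M by [].
rewrite -[leLHS](ger0_norm S0) -[S](subrKC s) (le_trans (ler_normD _ _))//.
by rewrite lerD// distrC ltW.
Qed.

Lemma square_summable_conj (f : X -> R[i]) :
  square_summable f -> square_summable (fun x => (f x)^*).
Proof.
move=> /square_summableP[M fM]; apply/square_summableP; exists M => A.
by under eq_bigr do rewrite norm_conjC.
Qed.
End square_summable_sums.

Section roots.
Variables (R : realType) (X : choiceType) (K : X -> X -> R[i]).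
Local Notation e_ := (@l2_basis R X).

Lemma pdms_root_l2 L : pdms_root K L -> l2_kernel L.
Proof.
move=> [L_pd LK] x.
have Lx : square_summable (L x).
  apply: (has_sum_square_summable (s := K x x)).
  by under eq_fun do rewrite -(pd_hermitian L_pd); exact: LK.
split=> //.
by under eq_fun do rewrite (pd_hermitian L_pd); exact: square_summable_conj.
Qed.

Lemma pdms_root_l2_factor : has_pdms_root K ->
  exists L : X -> X -> R[i], l2_kernel L /\ K = kernel_mul L (kernel_adj L).
Proof.
move=> [L LK]; exists L; split; first exact: pdms_root_l2.
case: LK => L_pd LK; apply/funext => x; apply/funext => z.
apply/esym/sum_has_sum; rewrite /kernel_adj.
by under eq_fun do rewrite -(pd_hermitian L_pd); exact: LK.
Qed.

Section rows.
Variables (L : X -> X -> R[i]) (L_l2 : l2_kernel L).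

Let row_subproof x : square_summable_pred (L x).
Proof. by apply/asboolP; case: (L_l2 x). Qed.

Definition kernel_row x : l2 R X := L2 (row_subproof x).

Let col_subproof x : square_summable_pred (fun y => (L y x)^*).
Proof. by apply/asboolP/square_summable_conj; case: (L_l2 x). Qed.

(** The coordinate [y] of the image of [u] is the inner product of [u] with a
    column, hence continuous in [u]. *)
Lemma kernel_row_closable : closable_family kernel_row.
Proof.
move=> h h0; apply: l2P => y; rewrite l2_0E; apply: norm_le_eps_eq0 => e e0.
pose c : l2 R X := L2 (col_subproof y).
have c1 : 0 < 1 + `|c| by rewrite ltr_pwDl.
have [|u [uf ue hu]] := h0 (e / (1 + `|c|)); first by rewrite divr_gt0.
rewrite -[h y](subrK (lfin_operator kernel_row u y)).
rewrite (le_trans (ler_normD _ _))//.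
have Tuy : lfin_operator kernel_row u y = inner u c.
  rewrite -inner_basisr (lfin_gram (k' := e_) (z' := c)).
  - by rewrite lfin_operator_id.
  - by move=> x; rewrite inner_basisr inner_basisl /= conjCK.
  - exact: uf.
have -> : e = e / (1 + `|c|) + e / (1 + `|c|) * `|c|.
  by rewrite -[X in _ = X + _]mulr1 -mulrDr divfK// gt_eqF.
rewrite lerD//.
  by rewrite -l2BE (le_trans (ler_l2_norm _ _))// ltW.
by rewrite Tuy (le_trans (inner_CauchySchwarz _ _))// ler_wpM2r// ltW.
Qed.
End rows.

Lemma l2_factor_closable : (exists L : X -> X -> R[i],
    l2_kernel L /\ K = kernel_mul L (kernel_adj L)) ->
  exists (H : hilbertType R) (T : operator (l2 R X) H),
    closable T /\ factorizes K T.
Proof.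
move=> [L [L_l2 ->]]; exists (l2 R X), (lfin_operator (kernel_row L_l2)).
split; first exact/closable_family_operator/kernel_row_closable.
by split=> // x y; rewrite !lfin_operator_basis.
Qed.

Lemma closable_positive_factor : positive_definite K ->
  (exists (H : hilbertType R) (T : operator (l2 R X) H),
    closable T /\ factorizes K T) ->
  exists B : operator (l2 R X) (l2 R X),
    [/\ positive_operator B, self_adjoint B, factorizes K B &
        is_core lfin B].
Proof.
move=> /feature_map_exists[k kK] [H [T [Tc [TD TK]]]].
have [|B [Bp Bs [BD Bk] Bc]] := @closable_family_positive _ _ k.
  apply: closable_family_transfer (closable_operator_family TD Tc) => x y.
  by rewrite -TK kK.
by exists B; split=> //; split=> // x y; rewrite -Bk kK.
Qed.

(** The root is the matrix of [B]; positivity of [B] on the vectors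
    [sum_j l_j e_(x_j)] is its positive definiteness. *)
Lemma positive_pdms_root : (exists B : operator (l2 R X) (l2 R X),
    [/\ positive_operator B, self_adjoint B, factorizes K B &
        is_core lfin B]) -> has_pdms_root K.
Proof.
move=> [B [Bp Bs [BD BK] Bc]].
have eD x : op_dom B (e_ x) by apply/BD/lfin_basis.
pose L x y := inner (B (e_ x)) (e_ y).
have L_pd : positive_definite L.
  move=> n x l.
  have [wD wE] : op_dom B (\sum_j l j *: e_ (x j)) /\
     B (\sum_j l j *: e_ (x j)) = \sum_j l j *: B (e_ (x j)).
    elim: (index_enum _) => [|j s [IHd IHe]].
      by rewrite !big_nil; split; [exact: op_dom0|exact: op_fun0].
    by rewrite !big_cons op_fun_linear// IHe; split=> //; exact: op_dom_linear.
  have := Bp _ wD; rewrite wE inner_suml; congr (0 <= _).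
  apply: eq_bigr => j _; rewrite inner_sumr; apply: eq_bigr => m _.
  by rewrite innerZl innerZr mulrA.
exists L; split=> // x z; rewrite BK.
under eq_fun => y do rewrite (pd_hermitian L_pd z y) /L !inner_basisr.
exact: l2_has_sum.
Qed.

End roots.

(** * Conditions on the reproducing kernel space *)

Lemma dense_exists (R : realType) (V : normedModType R[i]) (D : set V) v
    (e : R[i]) :
  dense D -> 0 < e -> exists2 u, D u & `|v - u| < e.
Proof.
move=> Dd e0; have [||u [ve Du]] := Dd (ball v e).
- by exists v; exact: ballxx.
- exact: ball_open.
- by exists u => //; move: ve; rewrite -ball_normE.
Qed.

Lemma lfin_sum_basis (R : realType) (X : choiceType) (V : lmodType R[i])
    (k : X -> V) (c : X -> R[i]) (s : seq X) :
  lfin (\sum_(x <- s) c x *: l2_basis R x) /\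
  lfin_operator k (\sum_(x <- s) c x *: l2_basis R x) =
    \sum_(x <- s) c x *: k x.
Proof.
elim: s => [|x s [IHf IHk]].
  by rewrite !big_nil; split; [exact: lfin0|exact: (op_fun0 (lfin_operator k))].
rewrite !big_cons; split; first by apply: lfin_linear => //; exact: lfin_basis.
rewrite (op_fun_linear (o := lfin_operator k))// ?IHk ?lfin_operator_basis//.
exact: lfin_basis.
Qed.

Section rkhs_theory.
Variables (R : realType) (X : choiceType) (K : X -> X -> R[i]) (H : rkhs K).
Local Notation e_ := (@l2_basis R X).
Local Notation k := (rkhs_kernel H).
Local Notation T := (kernel_op H).

Lemma rkhs_gram x y : inner (k x) (k y) = K x y.
Proof. by rewrite -rkhs_repr rkhs_kernelE. Qed.

Lemma rkhs_eq0 (h : H) : (forall x, inner h (k x) = 0) -> h = 0.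
Proof.
move=> h0; apply: (@rkhs_fun_inj _ _ _ H); apply/funext => x.
by rewrite rkhs_repr h0 raddf0.
Qed.

Lemma rkhs_span h : closure (op_range T) h.
Proof.
apply: total_closure_range => w w0; apply: rkhs_eq0 => x.
rewrite inner_conj -(lfin_operator_basis k x) w0 ?rmorph0//.
exact: lfin_basis.
Qed.

Lemma sum_kernelE u z : lfin u ->
  \sum_(x \in [set: X]) u x * K x z = inner (T u) (k z).
Proof.
move=> uf; have [A uA] := lfin_supp uf.
rewrite (@fsbigTE _ _ _ _ A); last by move=> x /uA ->; rewrite mul0r.
rewrite /= (lfin_extensionE _ uA) inner_suml.
by apply: eq_bigr => x _; rewrite innerZl rkhs_gram.
Qed.

Lemma kernel_unitE u : lfin u -> kernel_unit K u <-> `|T u| <= 1.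
Proof.
move=> uf; have [A uA] := lfin_supp uf.
suff : \sum_(x \in [set: X]) \sum_(y \in [set: X]) u x * (u y)^* * K x y =
    `|T u| ^+ 2 by rewrite /kernel_unit => ->; rewrite expr_le1.
rewrite (@fsbigTE _ _ _ _ A); last first.
  by move=> x /uA ->; rewrite fsbig1// => y _; rewrite !mul0r.
rewrite normr_inner /= (lfin_extensionE _ uA) inner_suml.
apply: eq_bigr => x _; rewrite (@fsbigTE _ _ _ _ A); last first.
  by move=> y /uA ->; rewrite rmorph0 mulr0 mul0r.
rewrite inner_sumr; apply: eq_bigr => y _.
by rewrite innerZl innerZr rkhs_gram mulrA.
Qed.

Section adjoint_domain.
Variable f : H.
Hypothesis f_l2 : square_summable (rkhs_fun H f).

Let f_subproof : square_summable_pred (rkhs_fun H f). Proof. exact/asboolP. Qed.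

(** The value at [f] of the adjoint of the kernel operator, see
    [inner_rkhs_l2]. *)
Definition rkhs_l2 : l2 R X := L2 f_subproof.

Lemma inner_rkhs_l2 u : lfin u -> inner (T u) f = inner u rkhs_l2.
Proof.
move=> uf; rewrite /kernel_op (lfin_gram (k' := e_) (z' := rkhs_l2)).
- by rewrite lfin_operator_id.
- by move=> x; rewrite inner_basisl /= rkhs_repr -inner_conj.
- exact: uf.
Qed.
End adjoint_domain.

Definition l2_dense := dense [set f : H | square_summable (rkhs_fun H f)].

Definition finite_set_control := forall (z : X) (e : R), 0 < e ->
  exists F : set X, [/\ finite_set F, F !=set0 &
    forall f : l2 R X, lfin f -> kernel_unit K f ->
      (forall x, F x -> f x = 0) -> `|f| <= 1 ->
      `|\sum_(x \in [set: X]) f x * K x z| <= e%:C%C].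

Definition finite_system_control := forall (z : X) (e : R), 0 < e ->
  exists (m : nat) (u : 'I_m.+1 -> l2 R X) (d : R),
    [/\ forall i j, inner (u i) (u j) = (i == j)%:R, 0 < d &
      forall v : l2 R X, lfin v -> kernel_unit K v ->
        (forall j, `|inner v (u j)| <= d%:C%C) ->
        `|\sum_(x \in [set: X]) v x * K x z| <= e%:C%C].

Definition weakly_null := forall alpha : nat -> l2 R X,
  (forall n, lfin (alpha n)) -> alpha n @[n --> \oo] --> 0 ->
  (forall n, kernel_unit K (alpha n)) -> forall z : X,
  (\sum_(x \in [set: X]) alpha n x * K x z) @[n --> \oo] --> (0 : R[i]).

(** Approximating the kernel section at [z] within [e] by a square-summable
    function [g] costs at most [e] on unit vectors. *)
Lemma dense_kernel_unit_bound z (e : R[i]) : l2_dense -> 0 < e ->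
  exists g : l2 R X, forall v, lfin v -> kernel_unit K v ->
    `|inner (T v) (k z)| <= e + `|inner v g|.
Proof.
move=> Hd e0; have [f f_l2 fz] := dense_exists (k z) Hd e0.
exists (rkhs_l2 f_l2) => v vf /(kernel_unitE vf) v1.
rewrite -inner_rkhs_l2// -[k z](subrK f) innerDr (le_trans (ler_normD _ _))//.
rewrite lerD// (le_trans (inner_CauchySchwarz _ _))//.
by rewrite -[leRHS]mul1r ler_pM// ltW.
Qed.

(** The finite set carries a finitely supported approximation of [g]. The
    point [x0] only makes it nonempty. *)
Lemma dense_finite_set_control (x0 : X) : l2_dense -> finite_set_control.
Proof.
move=> Hd z e e0; have e2 : 0 < e%:C%C / 2 :> R[i] by rewrite divr_gt0// ltcR.
have [g gP] := dense_kernel_unit_bound z Hd e2.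
have [w wf gw] := lfin_approx g e2; have [A wA] := lfin_supp wf.
exists [set` (x0 |` A)%fset]; split.
- exact: finite_fset.
- by exists x0 => /=; rewrite !inE eqxx.
move=> f ff f1 fA fn; rewrite sum_kernelE// (le_trans (gP f ff f1))//.
rewrite [leRHS]splitr lerD2l.
have fw : inner f w = 0.
  rewrite -(lfin_operator_id wf) (lfin_sum _ wA) inner_sumr.
  rewrite big1_seq// => x /= xA.
  by rewrite innerZr inner_basisr fA ?mulr0//= inE xA orbT.
rewrite -[g](subrK w) innerDr fw addr0 (le_trans (inner_CauchySchwarz _ _))//.
by rewrite -[leRHS]mul1r ler_pM// ltW.
Qed.

(** A single vector suffices: the direction of [g], or any basis vector when
    [g] vanishes. *)
Lemma dense_finite_system_control (x0 : X) : l2_dense -> finite_system_control.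
Proof.
move=> Hd z e e0; have e2 : 0 < e%:C%C / 2 :> R[i] by rewrite divr_gt0// ltcR.
have [g gP] := dense_kernel_unit_bound z Hd e2.
have [u1 [u1n gu]] : exists u1 : l2 R X, inner u1 u1 = 1 /\ g = `|g| *: u1.
  have [->|g0] := eqVneq g 0.
    by exists (e_ x0); rewrite normr0 scale0r inner_basis eqxx.
  have gn : `|g| != 0 by rewrite normr_eq0.
  exists (`|g|^-1 *: g); rewrite scalerA divff// scale1r; split=> //.
  rewrite -normr_inner normrZ normfV normr_id mulVf// expr1n//.
pose d := complex.Re (e%:C%C / 2 / (1 + `|g|)).
have g1 : 0 < 1 + `|g| by rewrite ltr_pwDl.
have dE : d%:C%C = e%:C%C / 2 / (1 + `|g|).
  by rewrite RRe_real// gtr0_real// divr_gt0.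
exists 0%N, (fun=> u1), d; split.
- by move=> i j; rewrite !ord1 eqxx u1n.
- by rewrite -ltcR dE divr_gt0.
move=> v vf v1 /(_ ord0) vd; rewrite sum_kernelE// (le_trans (gP v vf v1))//.
rewrite [leRHS]splitr lerD2l gu innerZr normrM norm_conjC normr_id.
rewrite (le_trans (ler_wpM2l _ vd))// dE mulrA ler_pdivrMr// mulrC.
by rewrite ler_wpM2l ?(ltW e2)// lerDr.
Qed.

Lemma finite_system_control_weakly_null : finite_system_control -> weakly_null.
Proof.
move=> E alpha af a0 a1 z; apply/cvgr0Pnorm_lt => e e0.
have eR : (complex.Re (e / 2))%:C%C = e / 2.
  by rewrite RRe_real// gtr0_real// divr_gt0.
have [|m [u [d [uu d0 uP]]]] := E z (complex.Re (e / 2)).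
  by rewrite -ltcR eR divr_gt0.
have d0' : 0 < d%:C%C :> R[i] by rewrite ltcR.
move/cvgr0Pnorm_lt : a0 => /(_ _ d0'); apply: filterS => n an.
apply: (@le_lt_trans _ _ (e / 2)); last first.
  by rewrite ltr_pdivrMr// mulr_natr mulr2n ltrDl.
rewrite -eR; apply: uP => // j.
have u1 : `|u j| = 1.
  by apply/eqP; rewrite -(@eqrXn2 _ 2)// normr_inner uu eqxx expr1n.
by rewrite (le_trans (inner_CauchySchwarz _ _))// u1 mulr1 ltW.
Qed.

(** The part of [alpha n] on the finite set tends to [0] together with its
    image, since it has finitely many coordinates; half of the remainder is a
    unit vector to which the control applies. *)
Lemma finite_set_control_weakly_null : finite_set_control -> weakly_null.
Proof.
move=> E alpha af a0 a1 z; apply/cvgr0Pnorm_lt => e e0.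
have e8 : 0 < e / 8 by rewrite divr_gt0.
have eR : (complex.Re (e / 8))%:C%C = e / 8 by rewrite RRe_real// gtr0_real.
have [|F [/finite_fsetP[A ->] _ FP]] := E z (complex.Re (e / 8)).
  by rewrite -ltcR eR.
pose p n : l2 R X := \sum_(x <- A) alpha n x *: e_ x.
have pf n : lfin (p n) by case: (lfin_sum_basis k (alpha n) A).
have Tp n : T (p n) = \sum_(x <- A) alpha n x *: k x.
  by case: (lfin_sum_basis k (alpha n) A).
have pA n x : x \in A -> p n x = alpha n x.
  move=> xA; rewrite -inner_basisr /p inner_suml (big_fsetD1 x)//=.
  rewrite innerZl inner_basis eqxx mulr1 big1_seq ?addr0// => y /=.
  by rewrite !inE => /andP[yx _]; rewrite innerZl inner_basis (negPf yx) mulr0.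
pose c := \sum_(x <- A) (1 + `|k x|).
have c0 : 0 <= c by apply: sumr_ge0 => x _; rewrite addr_ge0.
have p_le n : `|p n| <= `|alpha n| * c.
  rewrite /p (le_trans (ler_norm_sum _ _ _))// mulr_sumr ler_sum// => x _.
  rewrite normrZ ler_pM ?ler_l2_norm//.
  have -> : `|e_ x| = 1.
    by apply/eqP; rewrite -(@eqrXn2 _ 2)// normr_inner inner_basis eqxx expr1n.
  by rewrite lerDl.
have Tp_le n : `|T (p n)| <= `|alpha n| * c.
  rewrite Tp (le_trans (ler_norm_sum _ _ _))// mulr_sumr ler_sum// => x _.
  by rewrite normrZ ler_pM ?ler_l2_norm// lerDr.
pose M := 1 + c + c * `|k z|.
have M0 : 0 < M by rewrite /M -addrA ltr_pwDl// addr_ge0// mulr_ge0.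
have d1 : 0 < 1 / M by rewrite divr_gt0.
have d2 : 0 < e / 2 / M by rewrite !divr_gt0.
move/cvgr0Pnorm_lt : a0 => a0.
apply: filterS (filterI (a0 _ d1) (a0 _ d2)) => n [].
rewrite !ltr_pdivlMr// => an1 an2.
have ac : `|alpha n| * c <= `|alpha n| * M.
  by rewrite ler_wpM2l// /M addrAC lerDr addr_ge0// mulr_ge0.
pose q := alpha n - p n.
have qf : lfin q by exact: (op_domB (T := T) (af n) (pf n)).
have Tq : T q = T (alpha n) - T (p n).
  exact: (op_funB (T := T) (af n) (pf n)).
pose f := 2^-1 *: q.
have ff : lfin f by exact: (op_domZ (T := T) _ qf).
have Tf : T f = 2^-1 *: T q by exact: (op_funZ (T := T) _ qf).
have half (t : R[i]) : t <= 2 -> 2^-1 * t <= 1.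
  by move=> t2; rewrite ler_pdivrMl// mulr1.
have f1 : kernel_unit K f.
  apply/kernel_unitE => //; rewrite Tf normrZ normfV ger0_norm//; apply: half.
  rewrite Tq (le_trans (ler_normB _ _))// -[leRHS]/(1 + 1) lerD//.
    exact/kernel_unitE.
  by rewrite (le_trans (Tp_le n))// (le_trans ac)// ltW.
have fn : `|f| <= 1.
  rewrite normrZ normfV ger0_norm//; apply: half.
  rewrite (le_trans (ler_normB _ _))// -[leRHS]/(1 + 1) lerD//.
    rewrite (le_trans _ (ltW an1))// ler_peMr// /M -addrA lerDl.
    by rewrite addr_ge0// mulr_ge0.
  by rewrite (le_trans (p_le n))// (le_trans ac)// ltW.
have fA x : x \in A -> f x = 0.
  by move=> xA; rewrite /f l2ZE /q l2BE pA// subrr mulr0.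
have := FP f ff f1 fA fn; rewrite sum_kernelE// eR Tf innerZl normrM normfV.
rewrite normr_nat ler_pdivrMl// => Tqz.
rewrite sum_kernelE// -[T (alpha n)](subrK (T (p n))) -Tq innerDl.
rewrite (le_lt_trans (ler_normD _ _))//.
have -> : e = e / 2 + e / 2 by exact: splitr.
rewrite ler_ltD//.
  rewrite (le_trans Tqz)// -subr_ge0 (_ : _ - _ = e / 4); last by field.
  by rewrite divr_ge0 ?ltW.
rewrite (le_lt_trans (inner_CauchySchwarz _ _))//.
rewrite ltr_pdivlMr//; apply: le_lt_trans an2; rewrite ler_wpM2r//.
rewrite (le_trans (ler_wpM2r _ (Tp_le n)))// -mulrA ler_wpM2l// /M.
by rewrite lerDr addr_ge0.
Qed.

(** Vectors of a null sequence with convergent images become unit vectors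
    after a common rescaling, so the limit is orthogonal to all kernel
    sections. *)
Lemma weakly_null_closable_family : weakly_null -> closable_family k.
Proof.
move=> E h h0; apply: rkhs_eq0 => z.
have /choice[u uP] n : exists u, [/\ lfin u, `|u| < n.+1%:R^-1 &
    `|h - T u| < n.+1%:R^-1].
  by apply: h0; rewrite invr_gt0.
have uf n : lfin (u n) by case: (uP n).
have Tu : T (u n) @[n --> \oo] --> h.
  apply/cvgrPdist_lt => e /near_invSn_lt; apply: filterS => n.
  by apply: lt_trans; case: (uP n).
have u0 : u n @[n --> \oo] --> (0 : l2 R X).
  apply/cvgr0Pnorm_lt => e /near_invSn_lt; apply: filterS => n.
  by apply: lt_trans; case: (uP n).
pose M := 1 + `|h|; have M0 : 0 < M by rewrite ltr_pwDl.
have Mu n : `|T (u n)| <= M.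
  rewrite -[T _](subrK h) (le_trans (ler_normD _ _))// lerD// distrC.
  case: (uP n) => _ _ /ltW/le_trans; apply.
  by rewrite invf_le1// ler1n.
have af n : lfin (M^-1 *: u n) by exact: (op_domZ (T := T) _ (uf n)).
have := E (fun n => M^-1 *: u n) af _ _ z.
have -> : (fun n => \sum_(x \in [set: X]) (M^-1 *: u n) x * K x z) =
    fun n => M^-1 * inner (T (u n)) (k z).
  apply/funext => n; rewrite sum_kernelE; last exact: af.
  by rewrite (op_funZ (T := T) _ (uf n)) innerZl.
move=> Mz.
have Mh : M^-1 * inner (T (u n)) (k z) @[n --> \oo] --> M^-1 * inner h (k z).
  by apply: cvgM; [exact: cvg_cst|exact: cvg_innerl].
suff : M^-1 * inner h (k z) = 0.
  by move/eqP; rewrite mulf_eq0 invr_eq0 gt_eqF//= => /eqP.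
apply: cvg_unique_norm Mh (Mz _ _) => [|n].
  by rewrite -(scaler0 _ M^-1); exact: cvgZr.
apply/(kernel_unitE (af n)); rewrite (op_funZ (T := T) _ (uf n)) normrZ normfV.
by rewrite (gtr0_norm M0) ler_pdivrMl// mulr1.
Qed.

End rkhs_theory.

(** With the rows of [L] as a second family with Gram matrix [K], the function
    [L y] is represented in [H] by the vector corresponding to the projection
    of [e_y] onto the closed span of the rows. A vector orthogonal to all of
    these corresponds to a vector of [l2(X)] with all coordinates zero. *)
Lemma pdms_root_dense (R : realType) (X : choiceType) (K : X -> X -> R[i])
  (H : rkhs K) : has_pdms_root K -> l2_dense H.
Proof.
move=> [L LK]; have L_l2 := pdms_root_l2 LK; case: LK => L_pd LK.
pose l := kernel_row L_l2; pose k := rkhs_kernel H.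
have lK x z : inner (l x) (l z) = inner (k x) (k z).
  rewrite rkhs_gram; apply: sum_has_sum.
  by under eq_fun => y do rewrite /= -(pd_hermitian L_pd z y); exact: LK.
pose T' := lfin_operator l; pose T := lfin_operator k.
have gram u v : lfin u -> lfin v -> inner (T' u) (T' v) = inner (T u) (T v).
  exact: lfin_gram2.
have /choice[m mP] y : exists m : H, forall u, lfin u ->
    (T' u : l2 R X) y = inner (T u) m.
  have [|||m _ mP] := @riesz _ _ _ T (fun u => (T' u : l2 R X) y) 1.
  - by [].
  - by move=> a u v uf vf; rewrite op_fun_linear.
  - move=> u uf; rewrite mul1r (le_trans (ler_l2_norm _ _))//.
    by rewrite -ler_sqr ?nnegrE// !normr_inner gram.
  - by exists m.
pose D := [set f : H | square_summable (rkhs_fun H f)].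
have mD y : D (m y).
  rewrite /D /= (_ : rkhs_fun H (m y) = L y); first by case: (L_l2 y).
  apply/funext => x; rewrite rkhs_repr inner_conj.
  rewrite -[rkhs_kernel H x](lfin_operator_basis k x).
  rewrite -mP; last exact: lfin_basis.
  by rewrite /T' lfin_operator_basis; exact/esym/(pd_hermitian L_pd).
have D0 : D 0.
  rewrite /D /= raddf0; apply/square_summableP; exists 0 => A.
  by rewrite big1// => x _; rewrite normr0 expr0n.
have D_lin (a : R[i]) f g : D f -> D g -> D (a *: f + g).
  move=> /asboolP Df /asboolP Dg; rewrite /D /= linearP; apply/asboolP.
  exact: ((@square_summable_closed R X).2 a _ _ Df Dg).
pose I := Operator D0 D_lin (fun a u v _ _ => erefl (a *: u + v)).
apply: dense_approx => h e e0.
suff /closure_imageP/(_ _ e0)[f fD hf] : closure (op_range I) h by exists f.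
apply: total_closure_range => {}h hD.
have [//|u v uf vf||g _ gP] := @gram_limit _ _ _ _ T T' h.
- exact/esym/gram.
- exact: rkhs_span.
have g0 : g = 0.
  apply: l2P => y; rewrite -inner_basisr -(gP (m y) (l2_basis R y)).
    by rewrite inner_conj [inner _ h](hD _ (mD y)) rmorph0.
  by move=> u uf; rewrite inner_basisr mP.
apply: rkhs_eq0 => x; rewrite (gP _ (l x)) ?g0 ?inner0l// => u uf.
by apply: lfin_gram => // z; rewrite lK.
Qed.

(** * Decomposition into countable blocks *)

Section partition.
Variables (R : realType).

(** The support is covered by those of finitely supported approximations. *)
Lemma l2_countable_support (X : choiceType) (f : l2 R X) :
  countable [set x | f x != 0].
Proof.
have /choice[A AP] n : exists A : {fset X},
    forall x, x \notin A -> `|f x| < n.+1%:R^-1.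
  have [|w wf fw] := @lfin_approx R X f n.+1%:R^-1; first by rewrite invr_gt0.
  have [A wA] := lfin_supp wf; exists A => x /wA wx.
  by rewrite -[f x]subr0 -wx -l2BE (le_lt_trans (ler_l2_norm _ _)).
apply: (@sub_countable _ _ _ (\bigcup_n [set` A n])); last first.
  by apply: bigcup_countable => // n _; exact: countable_fset.
apply: subset_card_le => x /= fx; apply: contrapT => xA; move/negP: fx; apply.
apply/eqP/norm_le_eps_eq0 => e /near_invSn_lt[N _ /(_ N (leqnn N)) Ne].
rewrite ltW// (lt_trans _ Ne)// AP//; apply/negP => xN.
by apply: xA; exists N.
Qed.

Lemma has_sum0 (X : choiceType) : has_sum (fun _ : X => 0 : R[i]) 0.
Proof.
apply/has_sumP => e e0; exists fset0 => B _.
by rewrite big1 ?subrr ?normr0.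
Qed.

Variables (X : choiceType) (K : X -> X -> R[i]).

Section components.
Variable L : X -> X -> R[i].
Hypothesis LK : pdms_root K L.

Fixpoint reach x n : set X :=
  if n is m.+1 then \bigcup_(y in reach x m) [set z | L y z != 0] else [set x].

Definition component x := \bigcup_n reach x n.

Lemma component_refl x : component x x. Proof. by exists 0%N. Qed.

Lemma component_step x y z : component x y -> L y z != 0 -> component x z.
Proof. by move=> [n _ yn] yz; exists n.+1 => //; exists y. Qed.

Lemma component_min x (A : set X) : A x ->
  (forall y z, A y -> L y z != 0 -> A z) -> component x `<=` A.
Proof.
move=> Ax AL y [n _]; elim: n y => [|n IHn] y /=; first by move=> ->.
by move=> [z /IHn Az zy]; exact: AL zy.
Qed.

Lemma component_sub x y : component x y -> component y `<=` component x.
Proof. by move=> xy; apply: component_min => // z w; exact: component_step. Qed.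

Lemma component_sym x y : component x y -> component y x.
Proof.
move: y; apply: (@component_min _ [set y | component y x]).
  exact: component_refl.
move=> y z /= yx yz; apply: (@component_sub z y) => //.
apply: component_step (component_refl z) _.
by rewrite (pd_hermitian LK.1 y z) conjC_eq0.
Qed.

Lemma component_eq x y : component x y -> component y = component x.
Proof.
move=> xy; apply/seteqP; split; apply: component_sub => //.
exact: component_sym.
Qed.

Lemma component_countable x : countable (component x).
Proof.
apply: bigcup_countable => // n _; elim: n => [|n IHn] /=.
  exact: countable1.
apply: bigcup_countable => // y _.
exact: (l2_countable_support (kernel_row (pdms_root_l2 LK) y)).
Qed.

(** A product [L x w * L w y] vanishes unless [x], [w] and [y] lie in one
    component, so both [K] and its factorization split. *)
Lemma component_partition : exists (S : Type) (Xs : S -> set X),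
  [/\ partition [set: S] Xs [set: X],
    forall s, countable (Xs s),
    is_direct_sum Xs (fun s => restrict_kernel K (Xs s)) K &
    forall s, has_pdms_root (restrict_kernel K (Xs s))].
Proof.
pose S := set_type (range component); pose Xs (s : S) : set X := val s.
have SP (s : S) : exists x, Xs s = component x.
  by have /set_mem[x _ xs] := valP s; exists x.
have XsE (s : S) y : Xs s y -> Xs s = component y.
  by have [x ->] := SP s => xy; apply/esym/component_eq.
have Xs_uniq (s t : S) x : Xs s x -> Xs t x -> s = t.
  move=> sx tx; apply: val_inj.
  by rewrite -/(Xs s) -/(Xs t) (XsE s x)// (XsE t x).
have Xs_step (s : S) x y : Xs s x -> L x y != 0 -> Xs s y.
  move=> sx xy; rewrite (XsE s x)//; apply: component_step xy.
  exact: component_refl.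
exists S, Xs; split.
- split.
  + apply/seteqP; split=> // x _.
    exists (SigSub (mem_set (imageT component x))) => //.
    exact: component_refl.
  + by move=> s t _ _ [x [sx tx]]; exact: Xs_uniq sx tx.
  + by move=> s _; have [x ->] := SP s; exists x; exact: component_refl.
- by move=> s; have [x ->] := SP s; exact: component_countable.
- split=> // s t x y sx ty st.
  have := LK.2 x y; rewrite (_ : (fun _ => _) = fun=> 0).
    by move=> /sum_has_sum <-; exact/sum_has_sum/has_sum0.
  apply/funext => w; apply/eqP; rewrite mulf_eq0 -implyNb; apply/implyP => xw.
  apply: contra_notT st => wy; apply: (@Xs_uniq _ _ y) => //.
  by apply: (Xs_step _ w) => //; apply: (Xs_step _ x).
- move=> s; exists (restrict_kernel L (Xs s)); split.
    by move=> n x l; exact: (LK.1 n (val \o x) l).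
  move=> x z; apply/(@has_sum_image R _ _ val val_inj
    (fun w => L (val x) w * L w (val z))); last exact: LK.2.
  move=> w; rewrite mulf_eq0 negb_or => /andP[xw _].
  have ws : Xs s w by apply: Xs_step xw; exact/set_mem/valP.
  by exists (SigSub (mem_set ws)).
Qed.
End components.

(** The factor is the block sum of the roots; a sum over [X] of a product of
    two of its rows reduces to a sum over one block. *)
Lemma partition_l2_factor : (exists (S : Type) (Xs : S -> set X),
  [/\ partition [set: S] Xs [set: X],
    forall s, countable (Xs s),
    is_direct_sum Xs (fun s => restrict_kernel K (Xs s)) K &
    forall s, has_pdms_root (restrict_kernel K (Xs s))]) ->
  exists L : X -> X -> R[i], l2_kernel L /\ K = kernel_mul L (kernel_adj L).
Proof.
move=> [S [Xs [[Xcov Xtriv _] _ [_ K0] Kroot]]].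
have /choice[sg sgP] x : exists s, Xs s x.
  by have : [set: X] x by []; rewrite -Xcov => -[s _ sx]; exists s.
have Xs_uniq s t x : Xs s x -> Xs t x -> s = t.
  by move=> sx tx; apply: Xtriv => //; exists x.
pose rt s := sval (cid (Kroot s)).
have rtP s : pdms_root (restrict_kernel K (Xs s)) (rt s).
  by rewrite /rt; case: cid.
pose inj s x (p : Xs s x) : set_type (Xs s) := SigSub (mem_set p).
pose ext s x y : R[i] := match pselect (Xs s x), pselect (Xs s y) with
  | left p, left q => rt s (inj s x p) (inj s y q) | _, _ => 0 end.
have extE s (x y : set_type (Xs s)) : ext s (val x) (val y) = rt s x y.
  have xs : Xs s (val x) by exact/set_mem/valP.
  have ys : Xs s (val y) by exact/set_mem/valP.
  rewrite /ext; case: pselect => [p|//]; case: pselect => [q|//].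
  by congr rt; apply: val_inj.
have ext_supp s x y : ext s x y != 0 -> Xs s y.
  rewrite /ext; case: (pselect (Xs s x)) => p.
    by case: (pselect (Xs s y)) => q //; rewrite eqxx.
  by case: (pselect (Xs s y)) => q //; rewrite eqxx.
have ext_conj s x y : ext s y x = (ext s x y)^*.
  rewrite /ext; case: (pselect (Xs s x)) => p; case: (pselect (Xs s y)) => q;
    rewrite ?rmorph0//.
  exact: (pd_hermitian (rtP s).1).
pose L x y := ext (sg x) x y.
have sgE s x : Xs s x -> sg x = s by move=> sx; exact: Xs_uniq (sgP x) sx.
have L_conj x y : L y x = (L x y)^*.
  rewrite /L; have [<-|xy] := pselect (sg x = sg y); first exact: ext_conj.
  have -> : ext (sg y) y x = 0.
    apply/eqP; apply: contra_notT xy => h; exact: (sgE _ _ (ext_supp _ _ _ h)).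
  have -> : ext (sg x) x y = 0; last by rewrite rmorph0.
  apply/eqP; apply: contra_notT xy => h.
  exact/esym/(sgE _ _ (ext_supp _ _ _ h)).
have L_sum x z : has_sum (fun y => L x y * (L z y)^*) (K x z).
  have [xz|xz] := pselect (sg x = sg z); last first.
    rewrite (K0 (sg x) (sg z))// (_ : (fun _ => _) = fun=> 0).
      exact: has_sum0.
    apply/funext => y; apply/eqP; rewrite mulf_eq0 conjC_eq0 -implyNb.
    apply/implyP => /ext_supp xy; apply: contra_notT xz => /ext_supp.
    by apply: Xs_uniq xy.
  pose x' := inj _ _ (sgP x); have zs : Xs (sg x) z by rewrite xz; exact: sgP.
  pose z' := inj _ _ zs.
  have vinj := @val_inj _ _ (set_type (Xs (sg x))).
  apply/(@has_sum_image _ _ _ val vinj _) => [y|].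
    rewrite mulf_eq0 negb_or => /andP[/ext_supp ys _].
    by exists (inj _ _ ys).
  rewrite (_ : _ \o _ = fun y => rt (sg x) x' y * rt (sg x) y z').
    exact: (rtP (sg x)).2.
  apply/funext => y /=; rewrite -L_conj /L.
  rewrite (sgE (sg x)); last exact/set_mem/valP.
  by rewrite -!extE.
have L_l2 : l2_kernel L.
  have Lx x : square_summable (L x).
    exact: has_sum_square_summable (L_sum x x).
  move=> x; split=> //.
  rewrite (_ : L^~ x = fun y => (L x y)^*); first exact: square_summable_conj.
  by apply/funext => y; exact: L_conj.
exists L; split=> //; apply/funext => x; apply/funext => z.
apply/esym/sum_has_sum; exact: L_sum.
Qed.
End partition.

(** * The equivalence *)

Theorem theorem5p5 (R : realType) (X : choiceType) (K : X -> X -> R[i])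
    (X_nonempty : [set: X] !=set0) (K_pd : positive_definite K) :
  [<-> (* (a1) *)
       has_pdms_root K ;
       (* (a2) *)
       exists L : X -> X -> R[i],
         l2_kernel L /\ K = kernel_mul L (kernel_adj L) ;
       (* (b) *)
       exists (S : Type) (Xs : S -> set X),
         [/\ partition [set: S] Xs [set: X],
             forall s, countable (Xs s),
             is_direct_sum Xs (fun s => restrict_kernel K (Xs s)) K &
             forall s, has_pdms_root (restrict_kernel K (Xs s))] ;
       (* (c1) *)
       exists (H : hilbertType R) (T : operator (l2 R X) H),
         closable T /\ factorizes K T ;
       (* (c2) *)
       exists B : operator (l2 R X) (l2 R X),
         [/\ positive_operator B, self_adjoint B, factorizes K B &
             is_core lfin B] ;
       (* (c3) *)
       forall H : rkhs K, closable (kernel_op H) ;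
       (* (d) *)
       forall H : rkhs K, dense [set f : H | square_summable (rkhs_fun H f)] ;
       (* (e1) *)
       forall alpha : nat -> l2 R X,
         (forall n, lfin (alpha n)) ->
         alpha n @[n --> \oo] --> 0 ->
         (forall n, kernel_unit K (alpha n)) ->
         forall z : X,
           (\sum_(x \in [set: X]) alpha n x * K x z) @[n --> \oo] --> (0 : R[i]) ;
       (* (e2) *)
       forall (z : X) (e : R), 0 < e ->
         exists F : set X, [/\ finite_set F, F !=set0 &
           forall f : l2 R X, lfin f -> kernel_unit K f ->
             (forall x, F x -> f x = 0) -> `|f| <= 1 ->
             `|\sum_(x \in [set: X]) f x * K x z| <= e%:C%C] ;
       (* (e3) *)
       forall (z : X) (e : R), 0 < e ->
         exists (k : nat) (u : 'I_k.+1 -> l2 R X) (d : R),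
           [/\ forall i j, inner (u i) (u j) = (i == j)%:R, 0 < d &
             forall v : l2 R X, lfin v -> kernel_unit K v ->
               (forall j, `|inner v (u j)| <= d%:C%C) ->
               `|\sum_(x \in [set: X]) v x * K x z| <= e%:C%C] ].
Proof.
have [x0 _] := X_nonempty; have [H0] := rkhs_exists K_pd.
have closable_root : (exists (H : hilbertType R) (T : operator (l2 R X) H),
    closable T /\ factorizes K T) -> has_pdms_root K.
  by move=> /(closable_positive_factor K_pd)/positive_pdms_root.
have kernel_op_root : closable (kernel_op H0) -> has_pdms_root K.
  move=> H0c; apply: closable_root; exists H0, (kernel_op H0); split=> //.
  by split=> // x y; rewrite !lfin_operator_basis rkhs_gram.
have null_closable (H : rkhs K) : weakly_null K -> closable (kernel_op H).
  move=> K_null.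
  exact/closable_family_operator/weakly_null_closable_family.
have null_root : weakly_null K -> has_pdms_root K.
  by move=> K_null; exact/kernel_op_root/null_closable.
have set_null := finite_set_control_weakly_null H0.
have root_dense : has_pdms_root K -> forall H : rkhs K, l2_dense H.
  by move=> K_root H; exact: pdms_root_dense.
have dense_set : (forall H : rkhs K, l2_dense H) -> finite_set_control K.
  by move=> Hd; exact: dense_finite_set_control x0 (Hd H0).
have dense_system : (forall H : rkhs K, l2_dense H) -> finite_system_control K.
  by move=> Hd; exact: dense_finite_system_control x0 (Hd H0).
tfae.
- exact: pdms_root_l2_factor.
- move=> /l2_factor_closable/closable_root[L LK].
  exact: component_partition LK.
- by move=> /partition_l2_factor/l2_factor_closable.
- exact: closable_positive_factor.
- move=> /positive_pdms_root/root_dense Hd H; apply: null_closable.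
  exact/set_null/dense_set.
- by move=> Kc; apply/root_dense/kernel_op_root.
- by move=> Hd; apply/set_null/dense_set.
- by move=> /null_root/root_dense Hd; exact: dense_set.
- by move=> /set_null/null_root/root_dense Hd; exact: dense_system.
- by move=> /finite_system_control_weakly_null/null_root.
Qed.
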